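(* Let $(M,\alpha)$ be a closed connected contact manifold for which the Weinstein conjecture holds, i.e. whose Reeb flow admits at least one periodic orbit. Then there exists an infinite-dimensional space (in the sense specified in the context) of Riemannian metrics $g$ on $M$ such that $(M,g,\mathrm d\alpha)$ is of geodesic type, and consequently for every energy value $\kappa\in(0,\infty)$ there exists at least one periodic orbit of the magnetic geodesic flow $\Phi^t_{g,\mathrm d\alpha}$ with energy $\kappa$.
   Context: A contact manifold $(M,\alpha)$ is a manifold of dimension $2n+1$ with a one-form $\alpha$ such that $\alpha\wedge(\mathrm d\alpha)^n$ is nowhere zero. Its Reeb vector field $R_\alpha$ is defined by $\alpha(R_\alpha)=1$, $\mathrm d\alpha(R_\alpha,\cdot)=0$; its flow is the Reeb flow. For a metric $g$ on $M$ the Lorentz force $Y$ is defined by $g_q(Y_qu,v)=\mathrm d\alpha_q(u,v)$; magnetic geodesics are the smooth curves with $\nabla_{\dot\gamma}\dot\gamma=Y_\gamma\dot\gamma$; $\Phi^t_{g,\mathrm d\alpha}$ is the corresponding flow on $TM$; the energy is $\frac12g(\dot\gamma,\dot\gamma)$. $(M,g,\mathrm d\alpha)$ is of geodesic type if there is a smooth embedded loop $\gamma:\mathbb R/T\mathbb Z\to M$, $T>0$, that is a geodesic of $(M,g)$ with $\mathrm d\alpha_{\gamma(t)}(\dot\gamma(t),\cdot)=0$ for all $t$. ''Infinite-dimensional space'' means: such a $g$ (with loop $\gamma$) exists, and $g$ is prescribed only in a small neighbourhood of $\gamma$, being arbitrary outside. That is, for every (arbitrarily small) open neighbourhood $U$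 of $\gamma$, every metric $g'$ on $M$ that equals $g$ on $U$ also has the stated properties. *)

(* Defs.v *)
From HB Require Import structures.
From mathcomp Require Import all_boot all_order all_algebra all_fingroup.
From mathcomp Require Import all_classical all_reals all_analysis.

Set Implicit Arguments.
Unset Strict Implicit.
Unset Printing Implicit Defensive.

Import Order.TTheory GRing.Theory Num.Theory.
Import numFieldNormedType.Exports.

Local Open Scope classical_set_scope.
Local Open Scope ring_scope.

(* On an open [U] of a finite-dimensional [V], this is the usual C^k: quantifying
   over all directions [v] covers the basis vectors, hence the iterated partial
   derivatives. *)
Fixpoint Ck (R : realType) (V W : normedModType R) (k : nat) (U : set V)
    (f : V -> W) : Prop :=
  (forall x, U x -> {for x, continuous f}) /\
  if k is k'.+1 then
    forall v : V, (forall x, U x -> derivable f x v) /\ Ck k' U ('D_v f)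
  else True.

Definition smooth_on (R : realType) (V W : normedModType R) (U : set V)
  (f : V -> W) : Prop := forall k, Ck k U f.

(* A smooth manifold without boundary, given by an indexed smooth atlas.
   [phi c] is only meaningful on [dom c], and [psi c] on [phi c @` dom c]. *)
Record manifold (R : realType) (m : nat) := Manifold {
  points :> topologicalType;
  points_hausdorff : hausdorff_space points;
  points_second_countable : @second_countable points;
  charts : Type;
  dom : charts -> set points;
  phi : charts -> points -> 'rV[R]_m;
  psi : charts -> 'rV[R]_m -> points;
  dom_cover : forall q, exists c, dom c q;
  dom_open : forall c, open (dom c);
  cod_open : forall c, open (phi c @` dom c);
  phiK : forall c q, dom c q -> psi c (phi c q) = q;
  phi_continuous : forall c q, dom c q -> {for q, continuous (phi c)};
  psi_continuous : forall c x, (phi c @` dom c) x -> {for x, continuous (psi c)};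
  transition_smooth : forall c c',
    smooth_on (phi c @` (dom c `&` dom c')) (phi c' \o psi c)
}.
Arguments dom {R m M} c : rename.
Arguments phi {R m M} c : rename.
Arguments psi {R m M} c : rename.

(* The differential at [q] of the change of coordinates from [c] to [c']. *)
Definition dtrans (R : realType) (m : nat) (M : manifold R m)
  (c c' : charts M) (q : M) (v : 'rV[R]_m) : 'rV[R]_m :=
  'D_v (phi c' \o psi c) (phi c q).

(* The set TM: a tangent vector at [tbase] is the family of its components in the
   charts around [tbase], subject to the transformation law; components in the
   other charts are set to 0 so that equality in TM is Leibniz equality. *)
Record tangent_bundle (R : realType) (m : nat) (M : manifold R m) := TangentVector {
  tbase : M;
  tcomp : charts M -> 'rV[R]_m;
  tcomp_change : forall c c', dom c tbase -> dom c' tbase ->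
    tcomp c' = dtrans c c' tbase (tcomp c);
  tcomp_out : forall c, ~ dom c tbase -> tcomp c = 0
}.

(* Tensor fields are families of components [T c q] in the chart [c] at the point
   [q], meaningful for [q] in [dom c]. Vectors are rows, covectors are columns. *)
Record vector_field (R : realType) (m : nat) (M : manifold R m) := VectorField {
  vf_comp :> charts M -> M -> 'rV[R]_m;
  vf_change : forall c c' q, dom c q -> dom c' q ->
    vf_comp c' q = dtrans c c' q (vf_comp c q);
  vf_smooth : forall c, smooth_on (phi c @` dom c) (vf_comp c \o psi c)
}.

Record one_form (R : realType) (m : nat) (M : manifold R m) := OneForm {
  of_comp :> charts M -> M -> 'cV[R]_m;
  of_change : forall c c' q (v : 'rV[R]_m), dom c q -> dom c' q ->
    v *m of_comp c q = dtrans c c' q v *m of_comp c' q;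
  of_smooth : forall c, smooth_on (phi c @` dom c) (of_comp c \o psi c)
}.

Record riemannian_metric (R : realType) (m : nat) (M : manifold R m) := RiemannianMetric {
  rm_comp :> charts M -> M -> 'M[R]_m;
  rm_change : forall c c' q (u v : 'rV[R]_m), dom c q -> dom c' q ->
    u *m rm_comp c q *m v^T =
    dtrans c c' q u *m rm_comp c' q *m (dtrans c c' q v)^T;
  rm_sym : forall c q, dom c q -> (rm_comp c q)^T = rm_comp c q;
  rm_pos : forall c q (v : 'rV[R]_m), dom c q -> v != 0 ->
    0 < (v *m rm_comp c q *m v^T) 0 0;
  rm_smooth : forall c, smooth_on (phi c @` dom c) (rm_comp c \o psi c)
}.

Definition metric_eq_on (R : realType) (m : nat) (M : manifold R m)
  (U : set M) (g g' : riemannian_metric M) : Prop :=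
  forall c q, U q -> dom c q -> g c q = g' c q.

Definition partial (R : realType) (m : nat) (M : manifold R m)
  (c : charts M) (i : 'I_m) (f : M -> R) (q : M) : R :=
  'D_(delta_mx 0 i : 'rV[R]_m) (f \o psi c : 'rV[R]_m -> R) (phi c q).

(* Components of the exterior derivative:
   d alpha (u, v) = (u *m extd alpha c q *m v^T) 0 0. *)
Definition extd (R : realType) (m : nat) (M : manifold R m) (alpha : one_form M)
  (c : charts M) (q : M) : 'M[R]_m :=
  \matrix_(i, j) (partial c i (fun p => alpha c p j 0) q
                  - partial c j (fun p => alpha c p i 0) q).

Section wedge.
Variables (R : realType) (m : nat).

Definition kform (k : nat) := ('I_k -> 'rV[R]_m) -> R.

Definition wedge (k l : nat) (w : kform k) (h : kform l) : kform (k + l) :=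
  fun v => (k`!%:R * l`!%:R)^-1 *
    \sum_(s : 'S_(k + l)) (-1) ^+ s * w (fun i => v (s (lshift l i)))
                                    * h (fun j => v (s (rshift k j))).

Fixpoint wedge_pow (w : kform 2) (n : nat) : kform (n * 2) :=
  if n is n'.+1 then wedge w (@wedge_pow w n') else fun=> 1.

Definition form1 (a : 'cV[R]_m) : kform 1 := fun v => (v ord0 *m a) 0 0.

Definition form2 (b : 'M[R]_m) : kform 2 :=
  fun v => (v ord0 *m b *m (v ord_max)^T) 0 0.
End wedge.
Arguments wedge_pow {R m} w n.

Definition contact_form (R : realType) (n : nat) (M : manifold R n.*2.+1)
  (alpha : one_form M) : Prop :=
  forall c q, dom c q -> exists v,
    wedge (form1 (alpha c q)) (wedge_pow (form2 (extd alpha c q)) n) v != 0.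

Section curves.
Variables (R : realType) (m : nat) (M : manifold R m).
Implicit Types (gamma : R -> M) (theta : R -> tangent_bundle M).

Definition smooth_curve gamma : Prop :=
  continuous gamma /\
  forall c, smooth_on (gamma @^-1` dom c) (fun t : R => phi c (gamma t)).

Definition velocity gamma (c : charts M) (t : R) : 'rV[R]_m :=
  derive1 (fun s => phi c (gamma s)) t.

(* Meaningful for differentiable [gamma]: [theta] is t |-> (gamma t, gamma' t). *)
Definition velocity_lift gamma theta : Prop :=
  forall t, tbase (theta t) = gamma t /\
    forall c, dom c (gamma t) -> tcomp (theta t) c = velocity gamma c t.

Definition integral_curve (X : vector_field M) gamma : Prop :=
  smooth_curve gamma /\
  forall c t, dom c (gamma t) -> velocity gamma c t = X c (gamma t).

Definition periodic (T : Type) (f : R -> T) (p : R) : Prop :=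
  0 < p /\ forall t, f (t + p) = f t.

(* [gamma] induces a smooth embedding of R/TZ: an immersion, injective modulo T,
   which is a homeomorphism onto its image (last condition: continuity of the
   inverse, distances being taken in R/TZ). *)
Definition embedded_loop gamma (T : R) : Prop :=
  [/\ smooth_curve gamma,
      periodic gamma T,
      forall c t, dom c (gamma t) -> velocity gamma c t != 0,
      forall s t, gamma s = gamma t -> exists k : int, s = t + k%:~R * T &
      forall t (e : R), 0 < e -> exists2 W : set M, nbhs (gamma t) W &
        forall s, W (gamma s) -> exists k : int, `|s - t - k%:~R * T| < e].
End curves.

Definition is_Reeb (R : realType) (m : nat) (M : manifold R m)
  (alpha : one_form M) (X : vector_field M) : Prop :=
  forall c q, dom c q ->
    (X c q *m alpha c q) 0 0 = 1 /\ X c q *m extd alpha c q = 0.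

Definition has_periodic_Reeb_orbit (R : realType) (m : nat) (M : manifold R m)
  (alpha : one_form M) : Prop :=
  exists2 X : vector_field M, is_Reeb alpha X &
    exists (gamma : R -> M) (T : R), integral_curve X gamma /\ periodic gamma T.

Section magnetic.
Variables (R : realType) (m : nat) (M : manifold R m).
Variables (g : riemannian_metric M) (alpha : one_form M).
Implicit Types (gamma : R -> M) (theta : R -> tangent_bundle M).

Definition christoffel (c : charts M) (q : M) (k i j : 'I_m) : R :=
  2^-1 * \sum_(l < m) invmx (g c q) k l *
    (partial c i (fun p => g c p j l) q + partial c j (fun p => g c p i l) q
     - partial c l (fun p => g c p i j) q).

(* Components of nabla_{gamma'} gamma' for the Levi-Civita connection. *)
Definition covariant_acceleration gamma (c : charts M) (t : R) : 'rV[R]_m :=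
  derive1 (velocity gamma c) t +
  \row_k \sum_(i < m) \sum_(j < m) christoffel c (gamma t) k i j
                        * velocity gamma c t 0 i * velocity gamma c t 0 j.

Definition geodesic gamma : Prop :=
  smooth_curve gamma /\
  forall c t, dom c (gamma t) -> covariant_acceleration gamma c t = 0.

(* The Lorentz force is u |-> u *m lorentz_force c q; see lorentz_forceP. *)
Definition lorentz_force (c : charts M) (q : M) : 'M[R]_m :=
  extd alpha c q *m invmx (g c q).

Lemma metric_unit c q : dom c q -> g c q \in unitmx.
Proof.
move=> cq; rewrite -row_free_unit -kermx_eq0.
apply/negPn/negP => /rowV0Pn[v /sub_kermxP vg v0].
by have := rm_pos g cq v0; rewrite vg mul0mx mxE ltxx.
Qed.

Lemma lorentz_forceP c q (Y : 'M[R]_m) : dom c q ->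
  (forall u v : 'rV[R]_m, u *m Y *m g c q *m v^T = u *m extd alpha c q *m v^T)
  <-> Y = lorentz_force c q.
Proof.
move=> cq; have gU := metric_unit cq; split=> [YE|->]; last first.
  by move=> u v; rewrite /lorentz_force mulmxA mulmxKV.
suff E : Y *m g c q = extd alpha c q by rewrite /lorentz_force -E mulmxK.
apply/matrixP => i j; have := YE (delta_mx 0 i) (delta_mx 0 j).
rewrite -[_ *m Y *m _]mulmxA -!rowE trmx_delta -!colE => /matrixP/(_ 0 0).
by rewrite !mxE.
Qed.

Definition magnetic_geodesic gamma : Prop :=
  smooth_curve gamma /\
  forall c t, dom c (gamma t) ->
    covariant_acceleration gamma c t = velocity gamma c t *m lorentz_force c (gamma t).

(* The complete trajectories t |-> Phi^t (theta 0) of the magnetic geodesic flow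
   on TM. *)
Definition magnetic_flow_line theta : Prop :=
  exists2 gamma, magnetic_geodesic gamma & velocity_lift gamma theta.

(* The energy (1/2) g(w, w); the value does not depend on the chart. *)
Definition has_energy (w : tangent_bundle M) (kappa : R) : Prop :=
  forall c, dom c (tbase w) ->
    2^-1 * (tcomp w c *m g c (tbase w) *m (tcomp w c)^T) 0 0 = kappa.

Definition has_periodic_orbit_of_energy (kappa : R) : Prop :=
  exists (theta : R -> tangent_bundle M) (T : R),
    [/\ magnetic_flow_line theta, periodic theta T &
        forall t, has_energy (theta t) kappa].

Definition geodesic_type_loop gamma (T : R) : Prop :=
  [/\ embedded_loop gamma T,
      geodesic gamma &
      forall c t, dom c (gamma t) -> velocity gamma c t *m extd alpha c (gamma t) = 0].

Definition geodesic_type : Prop := exists gamma T, geodesic_type_loop gamma T.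
End magnetic.

(* Main.v *)
Require Import Defs.
From HB Require Import structures.
From mathcomp Require Import all_boot all_order all_algebra finmap.
From mathcomp Require Import all_classical all_reals all_analysis.
From mathcomp Require Import ring lra.

Set Implicit Arguments.
Unset Strict Implicit.
Unset Printing Implicit Defensive.

Import Order.TTheory GRing.Theory Num.Theory.
Import numFieldNormedType.Exports.
Local Open Scope classical_set_scope.
Local Open Scope ring_scope.

(** If a Riemannian metric [g] satisfies [g(X, _) = alpha] for the Reeb field [X],
    then [X] has unit length and [g(nabla_X X, _) = d alpha (X, _) = 0], so that the
    Reeb orbits are geodesics; as [d alpha (X, _) = 0] they are also magnetic
    geodesics, at any constant speed, which gives every energy.  Such a metric is
    [alpha (x) alpha + h(P _, P _)] with [P] the projection to [ker alpha] along [X]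
    and [h] any Riemannian metric, and the argument only uses [g] near the orbit.
    Uniqueness of integral curves turns a periodic Reeb orbit, run for its minimal
    period, into an embedded loop. *)

(** * Smooth functions *)

(** [Ck] speaks only of directional derivatives, which for a general map need not be linear in the
    direction. Linearity and the cocycle rule for coordinate changes therefore have to be earned:
    continuous partial derivatives give strict differentiability, an estimate on increments between
    two points that both vary. From it come the chain rule, the linearity of ['D_v] in [v], and the
    Lipschitz bound behind uniqueness of integral curves. The auxiliary metric [h] comes from
    compactness: finitely many Euclidean metrics, cut off inside charts, are added up, and
    positivity survives addition, so the cut-offs are never normalised to a partition of unity. The
    freedom in [g] has a limit: the identity [g(X, _) = alpha] gets differentiated in all
    directions, also those transverse to the orbit, so it is required on an open neighbourhood and
    not merely along the orbit. *)

Section Ck_calculus.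
Context {R : realType}.
Implicit Types (V W : normedModType R) (k : nat).

Lemma Ck_continuous V W k (U : set V) (f : V -> W) x :
  Ck k U f -> U x -> {for x, continuous f}.
Proof. by case: k => [|k] [fc _] Ux; exact: fc. Qed.

Lemma Ck_is_derive V W k (U : set V) (f : V -> W) x v :
  Ck k.+1 U f -> U x -> is_derive x v f ('D_v f x).
Proof. by move=> [_ /(_ v)[df _]] Ux; apply/derivableP/df. Qed.

Lemma Ck_derive V W k (U : set V) (f : V -> W) v :
  Ck k.+1 U f -> Ck k U ('D_v f).
Proof. by move=> [_ /(_ v)[_]]. Qed.

Lemma Ck_sub V W k (U U' : set V) (f : V -> W) :
  U `<=` U' -> Ck k U' f -> Ck k U f.
Proof.
move=> UU'; elim: k f => [|k IH] f [fc fd]; split => //.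
- by move=> x /UU'; exact: fc.
- by move=> x /UU'; exact: fc.
- by move=> v; have [d1 d2] := fd v; split=> [x /UU'|]; [exact: d1|exact: IH].
Qed.

(** Continuity and derivability at a point refer to full neighbourhoods in [V], so regularity on two
    sets simply adds up. This is what glues a cut-off tensor to its extension by 0. *)
Lemma CkU V W k (U U' : set V) (f : V -> W) :
  Ck k U f -> Ck k U' f -> Ck k (U `|` U') f.
Proof.
elim: k f => [|k IH] f [fc fd] [fc' fd']; split => //.
- by move=> x [/fc|/fc'].
- by move=> x [/fc|/fc'].
- move=> v; have [d1 d2] := fd v; have [d1' d2'] := fd' v.
  by split=> [x [/d1|/d1']//|]; exact: IH.
Qed.

Lemma Ck_eq V W k (U : set V) (f g : V -> W) :
  open U -> (forall x, U x -> f x = g x) -> Ck k U f -> Ck k U g.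
Proof.
move=> oU; elim: k f g => [|k IH] f g fg [fc fd].
  split=> // x Ux; have nfg : \forall y \near x, f y = g y.
    by apply: filterS (fg) _; exact: open_nbhs_nbhs.
  suff : g y @[y --> x] --> g x by [].
  rewrite -(fg x Ux); apply: cvg_trans (fc x Ux); exact: near_eq_cvg.
have nfg x : U x -> \forall y \near x, f y = g y.
  by move=> Ux; apply: filterS (fg) _; exact: open_nbhs_nbhs.
split=> [x Ux|v].
  suff : g y @[y --> x] --> g x by [].
  by rewrite -(fg x Ux); apply: cvg_trans (fc x Ux); exact/near_eq_cvg/nfg.
have [d1 d2] := fd v; split=> [x Ux|].
  exact: near_eq_derivable (nfg x Ux) (d1 x Ux).
by apply: IH d2 => x Ux; apply: near_eq_derive; exact: nfg.
Qed.

(** The recursion of [Ck] is on the function ['D_v f] itself; since [U] is open, a formula for the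
    derivative valid only on [U] may replace it. The closure properties follow by induction on [k]
    from the Leibniz and chain rules. *)
Lemma CkSI V W k (U : set V) (f : V -> W) (df : V -> V -> W) : open U ->
  (forall x, U x -> {for x, continuous f}) ->
  (forall v x, U x -> is_derive x v f (df v x)) ->
  (forall v, Ck k U (df v)) -> Ck k.+1 U f.
Proof.
move=> oU fc fd dfC; split=> // v; split=> [x /(fd v)[]//|].
by apply: Ck_eq (dfC v) => // x /(fd v)[].
Qed.

Lemma Ck_pred V W k (U : set V) (f : V -> W) : Ck k.+1 U f -> Ck k U f.
Proof.
elim: k f => [|k IH] f [fc fd]; split => // v.
by have [d1 d2] := fd v; split=> //; exact: IH.
Qed.

Lemma Ck_cst V W k (U : set V) (w : W) : Ck k U (cst w).
Proof.
elim: k w => [|k IH] w; split=> //; try by move=> x _; exact: cst_continuous.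
move=> v; split=> [x _|]; first exact: derivable_cst.
have -> : 'D_v (cst w : V -> W) = cst 0 by apply/funext => x; exact: derive_cst.
exact: IH.
Qed.

Lemma CkD V W k (U : set V) (f g : V -> W) : open U ->
  Ck k U f -> Ck k U g -> Ck k U (fun x => f x + g x).
Proof.
move=> oU; elim: k f g => [|k IH] f g Cf Cg.
  by split=> // x Ux; apply: cvgD; [exact: Ck_continuous Cf Ux|exact: Ck_continuous Cg Ux].
apply: (@CkSI _ _ _ _ _ (fun v x => 'D_v f x + 'D_v g x)) => //.
- by move=> x Ux; apply: cvgD; [exact: Ck_continuous Cf Ux|exact: Ck_continuous Cg Ux].
- move=> v x Ux; apply: is_deriveD; [exact: Ck_is_derive Cf Ux|exact: Ck_is_derive Cg Ux].
- by move=> v; apply: IH; exact: Ck_derive.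
Qed.

Lemma CkM V k (U : set V) (f g : V -> R) : open U ->
  Ck k U f -> Ck k U g -> Ck k U (fun x => f x * g x).
Proof.
move=> oU; elim: k f g => [|k IH] f g Cf Cg.
  by split=> // x Ux; apply: cvgM; [exact: Ck_continuous Cf Ux|exact: Ck_continuous Cg Ux].
apply: (@CkSI _ _ _ _ _ (fun v x => f x * 'D_v g x + g x * 'D_v f x)) => //.
- by move=> x Ux; apply: cvgM; [exact: Ck_continuous Cf Ux|exact: Ck_continuous Cg Ux].
- move=> v x Ux; apply: is_deriveM; [exact: Ck_is_derive Cf Ux|exact: Ck_is_derive Cg Ux].
- by move=> v; apply: CkD => //; apply: IH => //; (exact: Ck_derive || exact: Ck_pred).
Qed.

Lemma Ck_sum V W k (U : set V) (I : Type) (r : seq I) (f : I -> V -> W) :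
  open U -> (forall i, Ck k U (f i)) -> Ck k U (fun x => \sum_(i <- r) f i x).
Proof.
move=> oU fC; elim: r => [|i r IH].
  by apply: Ck_eq (Ck_cst k U 0) => // x _; rewrite big_nil.
by apply: Ck_eq (CkD oU (fC i) IH) => // x _; rewrite big_cons.
Qed.

Lemma continuous_mx (T : topologicalType) m n (f : T -> 'M[R]_(m, n)) x :
  {for x, continuous f} <-> forall i j, {for x, continuous (fun y => f y i j)}.
Proof.
split=> [fc i j|fc].
  apply: (@continuous_comp _ _ _ f (fun A : 'M[R]_(m, n) => A i j)); first exact: fc.
  exact: coord_continuous.
apply/cvgrPdist_le => /= e e0; near=> y.
rewrite /Num.Def.normr/= mx_normrE (bigmax_le _ (ltW e0))//= => i _.
rewrite !mxE/=; move: i; near: y; apply: filter_forall => /= i.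
exact: ((cvgrPdist_le _ _).1 (fc i.1 i.2)).
Unshelve. all: by end_near. Qed.

Lemma Ck_mx V m n k (U : set V) (f : V -> 'M[R]_(m, n)) : open U ->
  Ck k U f <-> forall i j, Ck k U (fun x => f x i j).
Proof.
move=> oU; elim: k f => [|k IH] f; split.
- by move=> [fc _] i j; split=> // x Ux; apply/(continuous_mx _ _).1/fc.
- by move=> fc; split=> // x Ux; apply/continuous_mx => i j; case: (fc i j) => + _; exact.
- move=> Cf i j; apply: (@CkSI _ _ _ _ _ (fun v x => 'D_v f x i j)) => //.
  + by move=> x Ux; apply: (continuous_mx _ _).1; exact: Ck_continuous Cf Ux.
  + move=> v x Ux; have [dfx _] := Ck_is_derive v Cf Ux.
    by apply: DeriveDef; [apply/(derivable_mxP _ _ _).1|rewrite derive_mx// mxE].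
  + by move=> v; apply/(IH _).1/Ck_derive.
- move=> Cf; have df v x : U x -> derivable f x v.
    move=> Ux; apply/derivable_mxP => i j.
    by case: (Ck_is_derive v (Cf i j) Ux).
  split=> [x Ux|v].
    by apply/continuous_mx => i j; exact: Ck_continuous (Cf i j) Ux.
  split=> [x|]; first exact: df.
  apply/IH => i j; apply: Ck_eq (Ck_derive v (Cf i j)) => // x Ux.
  by rewrite derive_mx ?mxE //; exact: df.
Qed.

Lemma Ck_mulmx V m n p k (U : set V) (f : V -> 'M[R]_(m, n))
    (g : V -> 'M[R]_(n, p)) : open U ->
  Ck k U f -> Ck k U g -> Ck k U (fun x => f x *m g x).
Proof.
move=> oU /Ck_mx-/(_ oU) Cf /Ck_mx-/(_ oU) Cg; apply/Ck_mx => // i j.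
apply: (@Ck_eq _ _ _ _ (fun x => \sum_l f x i l * g x l j)) => //.
  by move=> x _; rewrite mxE.
by apply: Ck_sum => // l; exact: CkM.
Qed.

Lemma Ck_tr V m n k (U : set V) (f : V -> 'M[R]_(m, n)) : open U ->
  Ck k U f -> Ck k U (fun x => (f x)^T).
Proof.
move=> oU /Ck_mx-/(_ oU) Cf; apply/Ck_mx => // i j.
by apply: Ck_eq (Cf j i) => // x _; rewrite mxE.
Qed.

(** The two difference quotients are the same function of [h], so the values of ['D] agree even
    where no limit exists. *)
Lemma derive_rescale V W (f : V -> W) (s : R) v :
  'D_v (fun x => f (s *: x)) = (fun x => 'D_(s *: v) f (s *: x)) /\
  forall x, derivable f (s *: x) (s *: v) -> derivable (fun x => f (s *: x)) x v.
Proof.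
have E x : (fun h => h^-1 *: (((fun x => f (s *: x)) \o shift x) (h *: v) - f (s *: x)))
       = (fun h => h^-1 *: ((f \o shift (s *: x)) (h *: (s *: v)) - f (s *: x))).
  apply/funext => h /=; congr (_ *: (f _ - _)).
  by rewrite scalerDr !scalerA [s * h]mulrC.
by split=> [|x]; [apply/funext => x; rewrite /derive E|rewrite /derivable E].
Qed.

Lemma Ck_rescale V W k (U : set V) (f : V -> W) (s : R) :
  Ck k U f -> Ck k ([set x | U (s *: x)]) (fun x => f (s *: x)).
Proof.
have sc (x : V) : {for x, continuous (fun y : V => s *: y)}.
  exact: scaler_continuous.
elim: k f => [|k IH] f Cf.
  split=> // x Ux.
  exact: (continuous_comp (sc x) (Ck_continuous Cf Ux)).
split=> [x Ux|v].
  exact: (continuous_comp (sc x) (Ck_continuous Cf Ux)).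
have [DE dE] := derive_rescale f s v.
split=> [x Ux|]; last by rewrite DE; exact: (IH ('D_(s *: v) f)) (Ck_derive _ Cf).
by apply: dE; case: (Ck_is_derive (s *: v) Cf Ux).
Qed.

End Ck_calculus.

(** * The chain rule for C^1 maps *)

Section strict_differentiability.
Context {R : realType} {m : nat}.
Implicit Types (f : 'rV[R]_m -> R) (x y z : 'rV[R]_m).

Lemma normr_coord_le p q (A : 'M[R]_(p, q)) i j : `|A i j| <= `|A|.
Proof.
rewrite [leRHS]/Num.Def.normr/= mx_normrE.
exact: (le_bigmax _ (fun ij => `|A ij.1 ij.2|) (i, j)).
Qed.

Lemma normr_mx_le p q (A : 'M[R]_(p, q)) (e : R) : 0 <= e ->
  (forall i j, `|A i j| <= e) -> `|A| <= e.
Proof.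
by move=> e0 Ae; rewrite [leLHS]/Num.Def.normr/= mx_normrE bigmax_le.
Qed.

Lemma MVT_norm (F dF : R -> R) (a b e : R) :
  (forall t, Num.min a b <= t <= Num.max a b -> is_derive t 1 F (dF t)) ->
  (forall t, Num.min a b <= t <= Num.max a b -> `|dF t| <= e) ->
  `|F b - F a| <= e * `|b - a|.
Proof.
wlog ab : a b / a <= b.
  move=> H; case/orP: (le_total a b) => [/H//|/H].
  by rewrite minC maxC (distrC (F _)) (distrC b).
rewrite min_l// max_r// => FdF dFe.
have [||c] := @MVT_segment _ F dF a b ab.
- by move=> t; rewrite in_itv/= => /andP[/ltW at_ /ltW tb]; apply: FdF; rewrite at_.
- by apply: derivable_within_continuous => t; rewrite in_itv/= => /FdF[].
by rewrite in_itv/= => cab ->; rewrite normrM ler_wpM2r// dFe.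
Qed.

(** Carries one-variable theorems (mean value, composition) over to directional derivatives. *)
Lemma is_derive_alongP (V W : normedModType R) (f : V -> W) (x v : V) (t : R) df :
  is_derive t 1 (fun h : R => f (h *: v + x)) df <->
  is_derive (t *: v + x) v f df.
Proof.
have E : (fun h : R => h^-1 *: (((fun h => f (h *: v + x)) \o shift t) (h *: 1) - f (t *: v + x)))
   = (fun h => h^-1 *: ((f \o shift (t *: v + x)) (h *: v) - f (t *: v + x))).
  by apply/funext => h /=; rewrite scalerDl addrA [_ *: 1]mulr1.
by split=> -[fd fE]; apply: DeriveDef; move: fd fE; rewrite /derivable /derive E.
Qed.

(* Changing the coordinates of [z] into those of [y] one at a time keeps all
   intermediate points in the ball, which is a box for the sup norm. *)
Lemma partial_increment f x (a : 'I_m -> R) (r e : R) : 0 <= e ->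
  (forall y i, ball x r y ->
     derivable f y (delta_mx 0 i) /\ `|'D_(delta_mx 0 i) f y - a i| <= e) ->
  forall y z, ball x r y -> ball x r z ->
  `|f y - f z - \sum_i a i * (y - z) 0 i| <= m%:R * e * `|y - z|.
Proof.
move=> e0 fa.
(* Induction on the number [k] of leading coordinates in which [y] and [z] may differ. The
   intermediate point [w] below takes its last such coordinate from [y] and all others from [z]. *)
suff H k : (k <= m)%N -> forall y z, ball x r y -> ball x r z ->
    (forall i : 'I_m, (k <= i)%N -> y 0 i = z 0 i) ->
    `|f y - f z - \sum_i a i * (y - z) 0 i| <= k%:R * e * `|y - z|.
  by move=> y z xy xz; apply: H => // i; rewrite leqNgt ltn_ord.
elim: k => [_|k IH km] y z xy xz yz.
  have -> : y = z by apply/rowP => i; apply: yz.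
  by rewrite subrr sub0r normrN big1 ?normr0 ?mulr_ge0// => i _; rewrite !mxE subrr mulr0.
pose l := Ordinal km.
pose d := (y - z) 0 l.
have [w wdef] : {w | w = d *: (delta_mx 0 l : 'rV[R]_m) + z} by eexists.
have ballE (p q : 'rV[R]_m) : ball p r q <-> 0 < r /\ forall i, `|p 0 i - q 0 i| < r.
  split=> [[r0 H]|[r0 H]].
    by split=> // i; exact: H.
  by split=> // i j; rewrite (ord1 i); exact: H.
have wl : w 0 l = y 0 l by rewrite wdef /d !mxE !eqxx /= mulr1 subrK.
have wE i : i != l -> w 0 i = z 0 i.
  by move=> il; rewrite wdef !mxE (negbTE il) andbF mulr0 add0r.
have xw : ball x r w.
  move/ballE : xy => [r0 xy]; move/ballE : xz => [_ xz]; apply/ballE; split=> // i.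
  by have [->|il] := eqVneq i l; [rewrite wl|rewrite wE].
have := IH (ltnW km) y w xy xw; rewrite -/l => {}IH.
have {}IH : `|f y - f w - \sum_i a i * (y - w) 0 i| <= k%:R * e * `|y - w|.
  apply: IH => i; rewrite leq_eqVlt => /predU1P[ki|ki].
    by have -> : i = l by apply/val_inj; rewrite /= -ki.
  by rewrite wE ?yz// -val_eqE/= gtn_eqF.
have yw : `|y - w| <= `|y - z|.
  apply: normr_mx_le => // i j; rewrite (ord1 i) !mxE.
  have [->|jl] := eqVneq j l; first by rewrite wl subrr normr0.
  by rewrite wE//; have := normr_coord_le (y - z) 0 j; rewrite !mxE.
have fwz : `|f w - f z - a l * d| <= e * `|d|.
  have bt t : Num.min 0 d <= t <= Num.max 0 d ->
      ball x r (t *: (delta_mx 0 l : 'rV[R]_m) + z).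
    move=> td; move/ballE : xw => [r0 xw]; move/ballE : xz => [_ xz].
    apply/ballE; split=> // i; have := xz i; have := xw i; rewrite wdef !mxE.
    have [il|il] := eqVneq i l; last by rewrite andbF !mulr0 !add0r.
    rewrite andbT/= !mulr1 !ltr_norml => /andP[h1 h2] /andP[h3 h4].
    by move: td; have [d0|d0] := leP 0 d => /andP[h5 h6]; apply/andP; split; lra.
  pose F t := f (t *: delta_mx 0 l + z) - a l * t.
  have := @MVT_norm F (fun t => 'D_(delta_mx 0 l) f (t *: delta_mx 0 l + z) - a l) 0 d e.
  rewrite /F scale0r add0r mulr0 !subr0 -wdef [f w - _ - _]addrAC; apply.
    move=> t /bt/(fa _ l)[fd _]; apply: is_deriveB.
      by apply/is_derive_alongP/derivableP.
    by rewrite -[X in is_derive _ _ _ X]mulr1; apply: is_deriveZ.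
  by move=> t /bt/(fa _ l)[].
have -> : \sum_i a i * (y - z) 0 i = \sum_i a i * (y - w) 0 i + a l * d.
  rewrite (bigD1 l)//= [in RHS](bigD1 l)//= [(y - w) 0 l]mxE [(- w) 0 l]mxE.
  rewrite wl subrr mulr0 add0r addrC; congr (_ + _).
  by apply: eq_bigr => i il; rewrite !mxE wE.
have dyz : `|d| <= `|y - z| by exact: normr_coord_le.
rewrite -natr1 mulrDl mul1r mulrDl.
have -> : f y - f z - (\sum_i a i * (y - w) 0 i + a l * d) =
  (f y - f w - \sum_i a i * (y - w) 0 i) + (f w - f z - a l * d) by ring.
apply: (le_trans (ler_normD _ _)); apply: lerD.
  by apply: (le_trans IH); rewrite ler_wpM2l// mulr_ge0.
by apply: (le_trans fwz); rewrite ler_wpM2l.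
Qed.

Lemma C1_increment (U : set 'rV[R]_m) f x (e : R) :
  open U -> U x -> Ck 1 U f -> 0 < e ->
  exists2 r : R, 0 < r & forall y z, ball x r y -> ball x r z ->
    `|f y - f z - \sum_i 'D_(delta_mx 0 i) f x * (y - z) 0 i| <= e * `|y - z|.
Proof.
(* [partial_increment] costs a factor [m]; the divisor [m.+1] absorbs it and is nonzero even for
   [m = 0]. *)
move=> oU Ux Cf e0; pose e' := e / m.+1%:R.
have e'0 : 0 < e' by rewrite divr_gt0.
pose P (i : 'I_m) y := derivable f y (delta_mx 0 i) /\
    `|'D_(delta_mx 0 i) f y - 'D_(delta_mx 0 i) f x| <= e'.
have : nbhs x [set y | forall i, P i y].
  apply: (@filter_forall _ _ P (nbhs x) (nbhs_filter x)) => i; near=> y; split.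
    have Uy : U y by near: y; exact: open_nbhs_nbhs.
    by case: (Ck_is_derive (delta_mx 0 i) Cf Uy).
  rewrite distrC; near: y.
  exact: ((cvgrPdist_le _ _).1 (Ck_continuous (Ck_derive (delta_mx 0 i) Cf) Ux)).
move=> /nbhs_ballP[r /= r0 H]; exists r => // y z xy xz.
have := @partial_increment f x (fun i => 'D_(delta_mx 0 i) f x) r e' (ltW e'0).
move=> /(_ (fun y i xy => H y xy i) y z xy xz) /le_trans; apply.
rewrite ler_wpM2r// /e' mulrCA ger_pMr// ler_pdivrMr// mul1r ler_nat.
exact: leqnSn.
Unshelve. all: by end_near. Qed.

Lemma C1_locally_lipschitz (U : set 'rV[R]_m) f x : open U -> U x -> Ck 1 U f ->
  exists2 L : R, 0 < L & exists2 r : R, 0 < r &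
    forall y z, ball x r y -> ball x r z -> `|f y - f z| <= L * `|y - z|.
Proof.
move=> oU Ux Cf; have [r r0 H] := C1_increment oU Ux Cf ltr01.
exists (1 + \sum_i `|'D_(delta_mx 0 i) f x|).
  by rewrite ltr_wpDr// sumr_ge0.
exists r => // y z xy xz; have := H y z xy xz.
set S := \sum_i _ * _ => fyz.
have -> : f y - f z = (f y - f z - S) + S by rewrite subrK.
apply: (le_trans (ler_normD _ _)); rewrite mulrDl; apply: lerD => //.
apply: (le_trans (ler_norm_sum _ _ _)); rewrite mulr_suml; apply: ler_sum => i _.
by rewrite normrM ler_wpM2l// normr_coord_le.
Qed.

(** The derivative is expressed by partial derivatives because linearity of ['D_v f] in [v] is
    itself a consequence: it is the case where [u] is the identity. *)
Lemma C1_chain f (U : set 'rV[R]_m) (V : normedModType R) (u : V -> 'rV[R]_m) t v du :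
  open U -> U (u t) -> Ck 1 U f -> is_derive t v u du ->
  is_derive t v (f \o u) (\sum_i 'D_(delta_mx 0 i) f (u t) * du 0 i).
Proof.
move=> oU Ut Cf [ud ud_val].
pose g h := h^-1 *: ((u \o shift t) (h *: v) - u t).
have gdu : g h @[h --> 0^'] --> du by rewrite -ud_val; exact: ud.
have uE h : h != 0 -> u (h *: v + t) = u t + h *: g h.
  by move=> h0; rewrite /g scalerA mulfV// scale1r subrKC.
have ut : u (h *: v + t) @[h --> 0^'] --> u t.
  have : u t + h *: g h @[h --> 0^'] --> u t + 0 *: du.
    apply: cvgD; first exact: cvg_cst.
    by apply: cvgZ => //; exact: (cvg_within_filter _ cvg_id).
  rewrite scale0r addr0; apply: cvg_trans; apply: near_eq_cvg.
  near=> h; apply/esym/uE; near: h; exact: nbhs_dnbhs_neq.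
set S := \sum_i _.
suff H : h^-1 *: ((f \o u \o shift t) (h *: v) - (f \o u) t) @[h --> 0^'] --> S.
  by apply: DeriveDef; [apply/cvg_ex; exists S|apply/cvg_lim].
have gS : \sum_i 'D_(delta_mx 0 i) f (u t) * g h 0 i @[h --> 0^'] --> S.
  apply: cvg_big => [|i _]; first exact: add_continuous.
  apply: cvgM; first exact: cvg_cst.
  exact: (cvg_comp _ _ gdu (@coord_continuous _ _ _ 0 i du)).
apply/cvgrPdist_le => e e0.
have K0 : 0 < `|du| + 1 by rewrite ltr_wpDl.
(* The difference quotient [g h] of [u] is eventually bounded by [|du| + 1], so this tolerance
   leaves an error of at most [e / 2] from [f]; the other half pays for replacing [g h] by [du]. *)
have [r r0 Hr] := C1_increment oU Ut Cf (divr_gt0 (divr_gt0 e0 (ltr0n _ 2)) K0).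
near=> h.
have h0 : h != 0 by near: h; exact: nbhs_dnbhs_neq.
have gK : `|g h| <= `|du| + 1.
  rewrite -lerBlDl; apply: (le_trans (lerB_dist _ _)); rewrite distrC.
  by near: h; apply: (cvgrPdist_le _ _).1.
have Sg : `|S - \sum_i 'D_(delta_mx 0 i) f (u t) * g h 0 i| <= e / 2.
  by near: h; apply: ((cvgrPdist_le _ _).1 gS); rewrite divr_gt0.
have ub : ball (u t) r (u (h *: v + t)).
  by near: h; exact: (ut _ (nbhsx_ballx _ _ r0)).
have := Hr _ _ ub (ballxx _ r0).
have -> : u (h *: v + t) - u t = h *: g h by rewrite uE// addrC addKr.
rewrite (eq_bigr (fun i => h * ('D_(delta_mx 0 i) f (u t) * g h 0 i))); last first.
  by move=> i _; rewrite !mxE mulrCA.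
rewrite -mulr_sumr normrZ /=.
set G := \sum_i _ in Sg *; set D := f _ - f _ => HD.
have -> : S - h^-1 *: D = (S - G) - h^-1 * (D - h * G).
  by rewrite mulrBr mulrA mulVf// mul1r opprB addrA addrNK.
apply: (le_trans (ler_normB _ _)); rewrite [leRHS]splitr; apply: lerD => //.
rewrite normrM normfV ler_pdivrMl ?normr_gt0//; apply: (le_trans HD).
rewrite mulrCA ler_wpM2l// -[leRHS](divfK (lt0r_neq0 K0)).
by rewrite ler_wpM2l// ltW// !divr_gt0.
Unshelve. all: by end_near. Qed.
End strict_differentiability.

(** * A flat function *)

Section flat_function.
Context {R : realType}.

(* The family [t^-n exp(-1/t)], extended by 0, is closed under differentiation up
   to linear combinations, so all its members are smooth. *)
Definition flat (n : nat) (t : R) : R :=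
  if 0 < t then t^-1 ^+ n * expR (- t^-1) else 0.

Lemma flat_ge0 n t : 0 <= flat n t.
Proof.
rewrite /flat; case: ifPn => // t0.
by rewrite mulr_ge0 ?expR_ge0// exprn_ge0// invr_ge0 ltW.
Qed.

Lemma flat_gt0 n t : (0 < flat n t) = (0 < t).
Proof.
rewrite /flat; have [t0|t0] := boolP (0 < t); last by rewrite ltxx.
by rewrite mulr_gt0 ?expR_gt0// exprn_gt0// invr_gt0.
Qed.

(** The exponential series gives [exp x >= x^(n+1) / (n+1)!] for [x = 1/t]; the power in excess of
    [n] leaves a factor [t], whence continuity at 0. *)
Lemma flat_le n t : `|flat n t| <= n.+1`!%:R * `|t|.
Proof.
rewrite ger0_norm ?flat_ge0//.
have [t0|t0] := ltP 0 t; last by rewrite /flat ltNge t0 mulr_ge0.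
rewrite /flat t0 gtr0_norm// expRN ler_pdivrMr ?expR_gt0//.
have tn0 : t != 0 by rewrite gt_eqF.
have tV0 : 0 <= t^-1 by rewrite invr_ge0 ltW.
have := expR_ge1Dxn n tV0; set E := expR _ => HE.
have -> : t^-1 ^+ n = n.+1`!%:R * t * (t^-1 ^+ n.+1 / n.+1`!%:R).
  rewrite exprS; field; rewrite tn0/= andbT pnatr_eq0 -lt0n fact_gt0//.
rewrite ler_pM2l; first by apply: le_trans HE; rewrite lerDr.
by rewrite mulr_gt0// ltr0n fact_gt0.
Qed.

Lemma flat_continuous0 n : {for 0, continuous (flat n)}.
Proof.
have f0 : flat n 0 = 0 by rewrite /flat ltxx.
apply/cvgrPdist_le => e e0; rewrite f0.
have n0 : 0 < n.+1`!%:R^-1 * e by rewrite mulr_gt0// invr_gt0 ltr0n fact_gt0.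
near=> t.
rewrite sub0r normrN; apply: (le_trans (flat_le _ _)).
rewrite -ler_pdivlMl ?ltr0n ?fact_gt0//; near: t.
Unshelve. all: by end_near. Qed.

Lemma is_derive_flat (n : nat) (t : R) :
  is_derive t 1 (flat n) (flat n.+2 t - n%:R * flat n.+1 t).
Proof.
have [t0|t0|<-] := ltgtP 0 t.
- apply: (@near_eq_is_derive R R R (fun s => s^-1 ^+ n * expR (- s^-1)) (flat n)).
    near=> s; rewrite /flat ifT//; near: s; exact: lt_nbhsr.
  rewrite /flat t0.
  have tn0 : t != 0 by rewrite gt_eqF.
  have dV : is_derive t 1 (fun s : R => s^-1) (- t ^- 2).
    have := @is_deriveV R id t 1 1 tn0 (is_derive_id t 1).
    by move=> /is_derive_eq; apply; rewrite [LHS]mulr1.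
  have dX : is_derive t 1 (fun s : R => s^-1 ^+ n) (n%:R * t^-1 ^+ n.-1 * - t ^- 2).
    have -> : (fun s : R => s^-1 ^+ n) = (fun s : R => s^-1) ^+ n.
      by apply/funext => s; rewrite exprfctE.
    have := is_deriveX n dV; move=> /is_derive_eq; apply.
    by rewrite -mulr_natl.
  have dE : is_derive t 1 (fun s : R => expR (- s^-1)) (expR (- t^-1) * t ^- 2).
    have := @is_derive1_comp R expR (fun s => - s^-1) t _ _ (is_derive_expR _) (is_deriveN dV).
    by move=> /is_derive_eq; apply; rewrite opprK.
  have := is_deriveM dX dE; move=> /is_derive_eq; apply.
  rewrite -[LHS]/(t^-1 ^+ n * (expR (- t^-1) * t ^- 2) +
                  expR (- t^-1) * (n%:R * t^-1 ^+ n.-1 * - t ^- 2)).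
  case: n {dX} => [|n]; first by rewrite !mul0r !mulr0 addr0 subr0 -exprVn expr0; ring.
  by rewrite /= -exprVn !exprS; ring.
- apply: (@near_eq_is_derive R R R (cst 0) (flat n)).
    near=> s; have s0 : s < 0 by near: s; exact: lt_nbhsl.
    by rewrite /flat ltNge (ltW s0).
  by rewrite /flat ltNge (ltW t0)/= mulr0 subr0; exact: is_derive_cst.
rewrite /flat ltxx mulr0 subr0 -/(flat n).
(* The difference quotient of [flat n] at 0 is [flat n.+1], already known to be continuous there. *)
have H : h^-1 *: ((flat n \o shift 0) (h *: 1) - flat n 0) @[h --> 0^'] --> (0 : R).
  have : flat n.+1 h @[h --> 0^'] --> (0 : R).
    have := @flat_continuous0 n.+1; rewrite /prop_for /continuous_at {2}/flat ltxx.
    by move=> H; apply: cvg_trans H; apply: cvg_app; exact: cvg_within.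
  apply: cvg_trans; apply: near_eq_cvg; near=> h.
  rewrite /= addr0 [h *: 1]mulr1 /flat ltxx subr0.
  case: ifPn => _; last by rewrite scaler0.
  by rewrite exprS -mulrA.
by apply: DeriveDef; [apply/cvg_ex; exists 0|apply/cvg_lim].
Unshelve. all: by end_near. Qed.

Lemma flat_continuous n : continuous (flat n).
Proof.
by move=> t; apply/differentiable_continuous/derivable1_diffP; case: (is_derive_flat n t).
Qed.

Lemma Ck_flat (V : normedModType R) k (U : set V) (u : V -> R) n : open U ->
  Ck k U u -> Ck k U (fun x => flat n (u x)).
Proof.
move=> oU; elim: k n u => [|k IH] n u Cu.
  split=> // x Ux.
  exact: (continuous_comp (Ck_continuous Cu Ux) (@flat_continuous n (u x))).
have Cu' := Ck_pred Cu.
apply: (@CkSI _ _ _ _ _ _ (fun v x =>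
  (flat n.+2 (u x) + - n%:R * flat n.+1 (u x)) * 'D_v u x)) => //.
- move=> x Ux.
  exact: (continuous_comp (Ck_continuous Cu Ux) (@flat_continuous n (u x))).
- move=> v x Ux; rewrite mulNr; have [ud ude] := Ck_is_derive v Cu Ux.
  pose w h := u (h *: v + x).
  have w0 : w 0 = u x by rewrite /w scale0r add0r.
  have dw : is_derive (0 : R) 1 w ('D_v u x).
    by apply/is_derive_alongP; rewrite scale0r add0r; exact: derivableP.
  have := is_derive1_comp (f := flat n) (x := 0) (g := w).
  rewrite w0 => /(_ _ _ (is_derive_flat n (u x)) dw).
  by move=> /(@is_derive_alongP _ _ _ (fun y => flat n (u y))); rewrite scale0r add0r.
- move=> v; apply: CkM => //; last exact: Ck_derive.
  apply: CkD => //; first exact: IH.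
  by apply: CkM => //; [exact: Ck_cst|exact: IH].
Qed.
End flat_function.

(** * Chain rule and linearity for matrix-valued C^1 maps *)

Section C1_matrix.
Context {R : realType} {m p q : nat}.
Implicit Types (f : 'rV[R]_m -> 'M[R]_(p, q)) (U : set 'rV[R]_m).

Lemma C1_derive_sum (f : 'rV[R]_m -> R) U x v : open U -> U x -> Ck 1 U f ->
  'D_v f x = \sum_i 'D_(delta_mx 0 i) f x * v 0 i.
Proof.
move=> oU Ux Cf; have := @C1_chain R m f U _ id x v v oU Ux Cf (is_derive_id x v).
by case.
Qed.

Lemma C1_comp f U (V : normedModType R) (u : V -> 'rV[R]_m) t v du :
  open U -> U (u t) -> Ck 1 U f -> is_derive t v u du ->
  is_derive t v (f \o u) ('D_du f (u t)).
Proof.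
move=> oU Ut Cf udu; have /(Ck_mx _ _ oU) Cfij := Cf.
have fij i j := C1_chain oU Ut (Cfij i j) udu.
have dfu : derivable (f \o u) t v.
  by apply/derivable_mxP => i j; case: (fij i j).
apply: DeriveDef => //; rewrite derive_mx//.
have [df _] := Ck_is_derive du Cf Ut.
rewrite derive_mx//; apply/matrixP => i j; rewrite !mxE.
by rewrite (C1_derive_sum _ oU Ut (Cfij i j)); case: (fij i j).
Qed.

Lemma C1_derive_linear f U x (a : R) v w : open U -> U x -> Ck 1 U f ->
  'D_(a *: v + w) f x = a *: 'D_v f x + 'D_w f x.
Proof.
move=> oU Ux Cf; have /(Ck_mx _ _ oU) Cfij := Cf.
have df u : derivable f x u by case: (Ck_is_derive u Cf Ux).
apply/matrixP => i j; rewrite !derive_mx// !mxE !(C1_derive_sum _ oU Ux (Cfij i j)).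
rewrite mulr_sumr -big_split/=; apply: eq_bigr => l _; rewrite !mxE; ring.
Qed.
End C1_matrix.

(** * Existence of Riemannian metrics *)

Section manifold_charts.
Context {R : realType} {m : nat} (M : manifold R m).
Implicit Types (c : charts M) (q : M).

Lemma chart_image_open c (W : set M) : open W -> open (phi c @` (dom c `&` W)).
Proof.
move=> oW; have -> : phi c @` (dom c `&` W) = phi c @` dom c `&` psi c @^-1` W.
  apply/seteqP; split=> [_ [q [cq Wq] <-]|_ [[q cq <-]]].
    by split; [exists q|rewrite /= phiK].
  by rewrite /= phiK// => Wq; exists q.
rewrite openE => x [Ux Wx]; apply: filterI.
  by apply: open_nbhs_nbhs; split=> //; exact: cod_open.
by apply: (psi_continuous Ux); exact: open_nbhs_nbhs.
Qed.

Lemma near_chart c q (W : set M) : dom c q -> open W -> W q ->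
  \forall x \near phi c q, exists p, [/\ dom c p, W p, phi c p = x & psi c x = p].
Proof.
move=> cq oW Wq.
have : nbhs (phi c q) (phi c @` (dom c `&` W)).
  by apply: open_nbhs_nbhs; split; [exact: chart_image_open|exists q].
by apply: filterS => x [p [cp Wp] <-]; exists p; rewrite phiK.
Qed.

Lemma C1_transition c c' : Ck 1 (phi c @` (dom c `&` dom c')) (phi c' \o psi c).
Proof. exact: transition_smooth. Qed.

Lemma is_derive_transition c c' q v : dom c q -> dom c' q ->
  is_derive (phi c q) v (phi c' \o psi c) (dtrans c c' q v).
Proof.
move=> cq c'q; apply: Ck_is_derive (C1_transition c c') _.
by exists q.
Qed.

Lemma dtrans_linear c c' q (a : R) u v : dom c q -> dom c' q ->
  dtrans c c' q (a *: u + v) = a *: dtrans c c' q u + dtrans c c' q v.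
Proof.
move=> cq c'q; apply: C1_derive_linear (C1_transition c c').
  by apply: chart_image_open; exact: dom_open.
by exists q.
Qed.

Lemma dtrans_comp c c' c'' q v : dom c q -> dom c' q -> dom c'' q ->
  dtrans c' c'' q (dtrans c c' q v) = dtrans c c'' q v.
Proof.
move=> cq c'q c''q.
have oU := @chart_image_open c' _ (dom_open c'').
have E : (phi c' \o psi c) (phi c q) = phi c' q by rewrite /= phiK.
have := C1_comp oU _ (C1_transition c' c'') (is_derive_transition v cq c'q).
rewrite E => /(_ (ex_intro2 _ _ q (conj c'q c''q) erefl))[_ dE].
apply: (etrans (esym dE)); apply: near_eq_derive.
have := near_chart cq (dom_open c') c'q; apply: filterS => x [p [cp c'p _ xp]].
by rewrite /= xp phiK.
Qed.

Lemma dtrans_id c q v : dom c q -> dtrans c c q v = v.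
Proof.
move=> cq; rewrite /dtrans (@near_eq_derive _ _ _ _ id) ?derive_id//.
have := near_chart cq (dom_open c) cq; apply: filterS => x [p [cp _ px xp]].
by rewrite /= xp px.
Qed.

Definition jac c c' q : 'M[R]_m :=
  \matrix_(i, j) dtrans c c' q (delta_mx 0 i) 0 j.

Lemma mul_jac c c' q v : dom c q -> dom c' q -> v *m jac c c' q = dtrans c c' q v.
Proof.
move=> cq c'q.
have dsum (r : seq 'I_m) : dtrans c c' q (\sum_(i <- r) v 0 i *: delta_mx 0 i) =
    \sum_(i <- r) v 0 i *: dtrans c c' q (delta_mx 0 i).
  elim: r => [|i r IH]; last by rewrite !big_cons dtrans_linear// IH.
  by rewrite !big_nil /dtrans derive0.
rewrite [in RHS](row_sum_delta v) dsum; apply/rowP => j; rewrite mxE summxE.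
by apply: eq_bigr => i _; rewrite !mxE.
Qed.
End manifold_charts.

Section Ck_more.
Context {R : realType}.

Lemma Ck_id (V : normedModType R) k (U : set V) : Ck k U id.
Proof.
case: k => [|k]; split=> //; try by move=> x _; exact: cvg_id.
move=> v; split=> [x _|]; first exact: derivable_id.
have -> : 'D_v id = cst v :> (V -> V) by apply/funext => x; exact: derive_id.
exact: Ck_cst.
Qed.

Lemma Ck_scale (V : normedModType R) m n k (U : set V) (s : V -> R)
    (f : V -> 'M[R]_(m, n)) : open U ->
  Ck k U s -> Ck k U f -> Ck k U (fun x => s x *: f x).
Proof.
move=> oU Cs /(Ck_mx _ _ oU) Cf; apply/(Ck_mx _ _ oU) => i j.
by apply: Ck_eq (CkM oU Cs (Cf i j)) => // x _; rewrite mxE.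
Qed.

(** The norm of ['rV[R]_m] is the sup norm, which is not smooth; bump functions are built from this
    polynomial instead. *)
Definition sqdist m (a y : 'rV[R]_m) : R := \sum_i (y 0 i + - a 0 i) * (y 0 i + - a 0 i).

Lemma Ck_sqdist (V : normedModType R) m k (U : set V) (u : V -> 'rV[R]_m) a :
  open U -> Ck k U u -> Ck k U (fun x => sqdist a (u x)).
Proof.
move=> oU /(Ck_mx _ _ oU) Cu; apply: Ck_sum => // i.
by apply: CkM => //; apply: CkD => //; exact: Ck_cst.
Qed.

Lemma sqdist_coord m (a y : 'rV[R]_m) (r : R) i : 0 <= r ->
  sqdist a y <= r * r -> `|y 0 i - a 0 i| <= r.
Proof.
move=> r0; rewrite /sqdist (bigD1 i)//= => /(le_trans _) H.
rewrite -(@ler_pXn2r _ 2)// ?nnegrE// !expr2 -normrM ger0_norm.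
  by apply: H; rewrite lerDl sumr_ge0// => j _; rewrite -expr2 sqr_ge0.
by rewrite -expr2 sqr_ge0.
Qed.
End Ck_more.

Section riemannian_existence.
Context {R : realType} {m : nat} (M : manifold R m).
Implicit Types (c : charts M) (q : M) (h : charts M -> M -> 'M[R]_m).

Lemma smooth_jac c c' k :
  Ck k (phi c @` (dom c `&` dom c')) (fun x => jac c c' (psi c x)).
Proof.
have oU := @chart_image_open _ _ _ c _ (dom_open c').
apply/(Ck_mx _ _ oU) => i j.
have := Ck_derive (delta_mx 0 i) (@transition_smooth _ _ M c c' k.+1).
move=> /(Ck_mx _ _ oU)/(_ 0 j); apply: Ck_eq => // _ [q [cq c'q] <-].
by rewrite mxE /dtrans !phiK.
Qed.

(** A Riemannian metric with definiteness weakened to nonnegativity, so that cut-off metrics qualify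
    and sums stay in the class. *)
Definition semimetric h : Prop :=
  [/\ forall c c' q (u v : 'rV[R]_m), dom c q -> dom c' q ->
        u *m h c q *m v^T = dtrans c c' q u *m h c' q *m (dtrans c c' q v)^T,
      forall c q, dom c q -> (h c q)^T = h c q,
      forall c q (v : 'rV[R]_m), dom c q -> 0 <= (v *m h c q *m v^T) 0 0 &
      forall c, smooth_on (phi c @` dom c) (h c \o psi c)].

Lemma semimetric_sum (I : Type) (r : seq I) (h : I -> charts M -> M -> 'M[R]_m) :
  (forall i, semimetric (h i)) ->
  semimetric (fun c q => \sum_(i <- r) h i c q).
Proof.
move=> hP; split.
- move=> c c' q u v cq c'q; rewrite !mulmx_sumr !mulmx_suml; apply: eq_bigr => i _.
  by case: (hP i) => + _ _ _; exact.
- move=> c q cq; rewrite raddf_sum; apply: eq_bigr => i _.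
  by case: (hP i) => _ + _ _; exact.
- move=> c q v cq; rewrite mulmx_sumr mulmx_suml summxE; apply: sumr_ge0 => i _.
  by case: (hP i) => _ _ + _; exact.
- move=> c k; apply: Ck_sum => [|i]; first exact: cod_open.
  by case: (hP i) => _ _ _; exact.
Qed.

Lemma mulmx_trmx_ge0 n (v : 'rV[R]_n) : 0 <= (v *m v^T) 0 0.
Proof. by rewrite mxE sumr_ge0// => i _; rewrite !mxE -expr2 sqr_ge0. Qed.

Lemma mulmx_trmx_gt0 n (v : 'rV[R]_n) : v != 0 -> 0 < (v *m v^T) 0 0.
Proof.
move=> /rV0Pn[i vi]; rewrite mxE (bigD1 i)//= ltr_wpDr//.
  by apply: sumr_ge0 => j _; rewrite !mxE -expr2 sqr_ge0.
by rewrite !mxE -expr2 exprn_even_gt0.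
Qed.

(* The pullback of the Euclidean metric by a chart, cut off by a bump function. *)
Lemma local_semimetric q : exists h (O : set M), [/\ semimetric h, open O, O q &
  forall c p (v : 'rV[R]_m), dom c p -> O p -> v != 0 -> 0 < (v *m h c p *m v^T) 0 0].
Proof.
have [c cq] := dom_cover q; pose a := phi c q.
have : nbhs a (phi c @` dom c).
  by apply: open_nbhs_nbhs; split; [exact: cod_open|exists q].
move=> /nbhs_ballP[rho /= rho0 aU]; pose r := rho / 2.
have r0 : 0 < r by rewrite divr_gt0.
pose box := [set y : 'rV[R]_m | forall i, `[a 0 i - r, a 0 i + r]%classic (y 0 i)].
have boxP y : box y <-> forall i, `|y 0 i - a 0 i| <= r.
  by split=> H i; have := H i; rewrite /= in_itv/= ler_distl.
have boxU : box `<=` phi c @` dom c.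
  move=> y /boxP yr; apply: aU; split=> // i j; rewrite (ord1 i) /ball/= distrC.
  by apply: (le_lt_trans (yr j)); rewrite /r ltr_pdivrMr// ltr_pMr// ltr1n.
(* [K] is compact, hence closed in the Hausdorff space [M], and the bump [b] vanishes off it. As [K]
   lies in [dom c], the open sets [dom c] and the complement of [K] cover [M]; [h] is smooth on the
   first by its formula and zero on the second. *)
pose K := psi c @` box.
have K_closed : closed K.
  apply: compact_closed; first exact: points_hausdorff.
  apply: continuous_compact; last first.
    apply: (@rV_compact _ _ (fun i => `[a 0 i - r, a 0 i + r]%classic)) => i.
    exact: segment_compact.
  apply: continuous_in_subspaceT => y; rewrite inE => /boxU.
  exact: psi_continuous.
pose b p := if `[< dom c p >] then flat 0 (r * r - sqdist a (phi c p)) else 0.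
have b_ge0 p : 0 <= b p by rewrite /b; case: ifP => // _; exact: flat_ge0.
have bK p : ~ K p -> b p = 0.
  rewrite /b; case: asboolP => // cp; apply: contra_notP => /eqP b0.
  have := flat_ge0 0 (r * r - sqdist a (phi c p)).
  rewrite le_eqVlt eq_sym (negbTE b0)/= flat_gt0 subr_gt0 => /ltW H.
  exists (phi c p); last exact: phiK.
  by apply/boxP => i; apply: sqdist_coord => //; exact: ltW.
(* Outside [dom c] the matrix [jac c' c p] is meaningless, but there [b p] is 0. *)
have [h hdef] : {h | forall c' p, h c' p = b p *: (jac c' c p *m (jac c' c p)^T)}.
  by exists (fun c' p => b p *: (jac c' c p *m (jac c' c p)^T)).
pose O := [set p | dom c p /\ sqdist a (phi c p) < r * r].
have hE c' p (u v : 'rV[R]_m) : dom c' p ->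
    u *m h c' p *m v^T = b p *: (dtrans c' c p u *m (dtrans c' c p v)^T).
  move=> c'p; rewrite hdef /b; case: asboolP => [cp|_]; last first.
    by rewrite !scale0r mulmx0 mul0mx.
  rewrite -scalemxAr -scalemxAl -!mul_jac// trmx_mul; congr (_ *: _).
  by rewrite !mulmxA.
exists h, O; split.
- split.
  + move=> c1 c2 p u v c1p c2p; rewrite (hE c1 p u v c1p) (hE c2 p _ _ c2p).
    have [cp|cp] := pselect (dom c p); first by rewrite !dtrans_comp.
    have bp0 : b p = 0 by rewrite /b asboolF.
    by rewrite bp0 !scale0r.
  + by move=> c' p c'p; rewrite hdef linearZ/= trmx_mul trmxK.
  + move=> c' p v c'p; rewrite hE// mxE mulr_ge0// mulmx_trmx_ge0//.
  + move=> c' k.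
    have oK : open (~` K) by exact: closed_openC.
    have oU1 := @chart_image_open _ _ _ c' _ (dom_open c).
    have oU2 := @chart_image_open _ _ _ c' _ oK.
    apply: (@Ck_sub _ _ _ _ _ (phi c' @` (dom c' `&` dom c) `|` phi c' @` (dom c' `&` ~` K))).
      move=> _ [p c'p <-].
      have [cp|cp] := pselect (dom c p); [left|right]; exists p => //; split=> //.
      by move=> [y /boxU[p' c'p' <-]]; rewrite phiK// => p'p; apply: cp; rewrite -p'p.
    apply: CkU; last first.
      apply: Ck_eq (Ck_cst _ _ 0) => // _ [p [c'p Kp] <-] /=.
      by rewrite phiK// hdef bK// scale0r.
    apply: (@Ck_eq _ _ _ _ _ (fun x => flat 0 (r * r + -1 * sqdist a ((phi c \o psi c') x)) *:
       (jac c' c (psi c' x) *m (jac c' c (psi c' x))^T))) => //.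
      move=> _ [p [c'p cp] <-] /=; rewrite phiK// hdef /b; case: asboolP => // _.
      by rewrite mulN1r.
    apply: Ck_scale => //.
      apply: Ck_flat => //; apply: CkD => //; first exact: Ck_cst.
      apply: CkM => //; first exact: Ck_cst.
      by apply: Ck_sqdist => //; exact: transition_smooth.
    by apply: Ck_mulmx => //; [|apply: Ck_tr => //]; exact: smooth_jac.
- rewrite openE => p [cp pr]; apply: filterI.
    by apply: open_nbhs_nbhs; split=> //; exact: dom_open.
  have sc : {for phi c p, continuous (sqdist a)}.
    by apply: (@Ck_continuous _ _ _ 0 setT) => //; apply: Ck_sqdist; [exact: openT|exact: Ck_id].
  have /(_ [set t | t < r * r]) := continuous_comp (phi_continuous cp) sc; apply.
  by apply: open_nbhs_nbhs; split; [exact: open_lt|exact: pr].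
- split=> //; rewrite /sqdist big1 ?mulr_gt0// => i _; rewrite -/a subrr mulr0//.
- move=> c' p v c'p [cp pr] v0; rewrite hE// mxE mulr_gt0//.
    by rewrite /b; case: asboolP => // _; rewrite flat_gt0 subr_gt0.
  (* [dtrans c' c p] is injective, with left inverse [dtrans c c' p]. *)
  apply: mulmx_trmx_gt0; apply: contra_neq v0 => dv0.
  by rewrite -(dtrans_id v c'p) -(dtrans_comp v c'p cp c'p) dv0 /dtrans derive0.
Qed.

(** All summands are nonnegative, and at each point at least one of the finitely many is definite;
    hence so is the sum. The point [q0] makes [M] a pointed space, the setting in which
    [compact_cover] is applied. *)
Lemma riemannian_metric_exists (q0 : M) : compact [set: M] -> inhabited (riemannian_metric M).
Proof.
move=> cM.
have hex q : exists hO : (charts M -> M -> 'M[R]_m) * set M,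
  [/\ semimetric hO.1, open hO.2, hO.2 q &
  forall c p (v : 'rV[R]_m), dom c p -> hO.2 p -> v != 0 -> 0 < (v *m hO.1 c p *m v^T) 0 0].
  by have [h [B hB]] := local_semimetric q; exists (h, B).
have [h hP] := choice hex.
pose M' : ptopologicalType := HB.pack (points M) (isPointed.Build (points M) q0).
have : @cover_compact M' setT by rewrite -compact_cover; exact: cM.
move=> /(_ M setT (fun q => (h q).2)) [||D _ Dcov].
- by move=> q _; case: (hP q).
- by move=> q _; exists q => //; case: (hP q).
have [S1 S2 S3 S4] := @semimetric_sum _ (enum_fset D) (fun q => (h q).1)
  (fun q => let: And4 a _ _ _ := hP q in a).
constructor; apply: (RiemannianMetric S1 S2 _ S4) => c p v cp v0.
have [q qD qp] := Dcov p I.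
rewrite mulmx_sumr mulmx_suml summxE.
have qD' : q \in enum_fset D by [].
rewrite (big_rem q)//= ltr_wpDr//.
  by apply: sumr_ge0 => i _; case: (hP i) => -[_ _ + _] _ _ _; exact.
by case: (hP q) => _ _ _; exact.
Qed.
End riemannian_existence.

(** * Reeb orbits as geodesics *)

Section geodesic_algebra.
Context {R : realType} {n : nat}.
(* [dX i k], [da i k] and [dg i j l] stand for the i-th partial derivatives of
   [X k], [a k] and [G j l]. *)
Variables (G : 'M[R]_n) (X a : 'I_n -> R) (dX da : 'I_n -> 'I_n -> R).
Variable dg : 'I_n -> 'I_n -> 'I_n -> R.
Hypotheses (G_sym : G^T = G) (G_unit : G \in unitmx).
Hypothesis XG : forall l, \sum_j X j * G j l = a l.
Hypothesis dXG : forall i l, da i l = \sum_j (X j * dg i j l + G j l * dX i j).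
Hypothesis dXa : forall l, \sum_i (X i * da l i + a i * dX l i) = 0.
Hypothesis Xda : forall l, \sum_i X i * (da i l - da l i) = 0.

(** Lowering the index [k] with [G] turns the first sum into [D - B] and the Christoffel sum into
    [B - Q / 2]. They cancel because [Q = 2 * D], which combines [Xda] (the field annihilates
    [d alpha]) with [dXa] ([alpha(X)] is constant). *)
Lemma geodesic_sum k :
  \sum_i X i * dX i k + \sum_i \sum_j
    (2^-1 * \sum_l invmx G k l * (dg i j l + dg j i l - dg l i j)) * X i * X j = 0.
Proof.
pose A k := \sum_i X i * dX i k.
pose B l := \sum_i \sum_j X i * X j * dg i j l.
pose Q l := \sum_i \sum_j X i * X j * dg l i j.
pose D l := \sum_i X i * da i l.
have DE l : D l = \sum_i X i * da l i.
  apply/eqP; rewrite -subr_eq0 -sumrB; apply/eqP; rewrite -[RHS](Xda l).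
  by apply: eq_bigr => i _; rewrite mulrBr.
have QE l : Q l = 2 * D l.
  have aX : \sum_i a i * dX l i = - D l.
    by apply/eqP; rewrite -addr_eq0 DE addrC -big_split/= dXa.
  have : D l = Q l + \sum_i a i * dX l i.
    rewrite DE; under eq_bigr do rewrite dXG mulr_sumr.
    under eq_bigr do under eq_bigr do rewrite mulrDr.
    under eq_bigr do rewrite big_split/=.
    rewrite big_split/=; congr (_ + _).
      rewrite exchange_big/=; apply: eq_bigr => i _; apply: eq_bigr => j _; ring.
    rewrite exchange_big/=; apply: eq_bigr => j _.
    rewrite -XG mulr_suml; apply: eq_bigr => i _.
    by rewrite -[in LHS]G_sym mxE mulrA.
  by rewrite aX => /eqP; rewrite eq_sym subr_eq => /eqP->; rewrite mulr2n mulrDl mul1r.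
have AG l : \sum_k A k * G k l = D l - B l.
  apply/eqP; rewrite eq_sym subr_eq; apply/eqP.
  rewrite /D; under eq_bigr do rewrite dXG mulr_sumr.
  under eq_bigr do under eq_bigr do rewrite mulrDr.
  under eq_bigr do rewrite big_split/=.
  rewrite big_split/= addrC; congr (_ + _).
    rewrite exchange_big/=; apply: eq_bigr => j _; rewrite mulr_suml.
    by apply: eq_bigr => i _; ring.
  by apply: eq_bigr => i _; apply: eq_bigr => j _; ring.
have E : \sum_i \sum_j
    (2^-1 * \sum_l invmx G k l * (dg i j l + dg j i l - dg l i j)) * X i * X j =
    \sum_l invmx G k l * (B l - D l).
  transitivity (\sum_i \sum_j \sum_l 2^-1 * invmx G k l *
      (X i * X j * dg i j l + X i * X j * dg j i l - X i * X j * dg l i j)).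
    apply: eq_bigr => i _; apply: eq_bigr => j _.
    rewrite mulr_sumr !mulr_suml; apply: eq_bigr => l _; ring.
  under eq_bigr do rewrite exchange_big/=.
  rewrite exchange_big/=; apply: eq_bigr => l _.
  under eq_bigr do rewrite -mulr_sumr.
  rewrite -mulr_sumr.
  under eq_bigr do rewrite sumrB big_split/=.
  rewrite sumrB big_split/= -/(B l) -/(Q l).
  have -> : \sum_i \sum_j X i * X j * dg j i l = B l.
    by rewrite exchange_big/=; apply: eq_bigr => i _; apply: eq_bigr => j _; ring.
  by rewrite QE; field.
have invG_sym : (invmx G)^T = invmx G by rewrite trmx_inv G_sym.
have AE : \sum_l invmx G k l * (D l - B l) = A k.
  transitivity (((\row_i A i) *m G *m invmx G) 0 k); last by rewrite mulmxK// mxE.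
  rewrite [RHS]mxE; apply: eq_bigr => l _.
  rewrite -AG mulrC -[in LHS]invG_sym [in LHS]mxE; congr (_ * _).
  by rewrite mxE; apply: eq_bigr => i _; rewrite mxE.
rewrite E -/(A k) -AE -big_split/= big1// => l _; ring.
Qed.
End geodesic_algebra.

(** * The metric adapted to the Reeb field *)

Section reeb_metric.
Context {R : realType} {m : nat} (M : manifold R m).
Variables (alpha : one_form M) (X : vector_field M).
Hypothesis X_Reeb : is_Reeb alpha X.
Implicit Types (c : charts M) (q : M).

Lemma Reeb_alpha c q : dom c q -> X c q *m alpha c q = 1%:M.
Proof. by move=> /X_Reeb[Xa _]; rewrite [LHS]mx11_scalar Xa. Qed.

Lemma Reeb_neq0 c q : dom c q -> X c q != 0.
Proof.
move=> /X_Reeb[+ _]; apply: contra_eq_neq => ->.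
by rewrite mul0mx mxE eq_sym oner_eq0.
Qed.

(* The metric making [X] a unit vector orthogonal to [ker alpha], on which it
   coincides with [h]. *)
Lemma Reeb_metric (h : riemannian_metric M) : exists g : riemannian_metric M,
  forall c q, dom c q -> X c q *m g c q = (alpha c q)^T.
Proof.
pose P c q : 'M[R]_m := 1%:M - alpha c q *m X c q.
pose g c q := alpha c q *m (alpha c q)^T + P c q *m h c q *m (P c q)^T.
have uP c q (u : 'rV[R]_m) : u *m P c q = - (u *m alpha c q) 0 0 *: X c q + u.
  rewrite mulmxBr mulmx1 mulmxA {1}[u *m alpha c q]mx11_scalar mul_scalar_mx.
  by rewrite scaleNr addrC.
have gE c q (u v : 'rV[R]_m) : u *m g c q *m v^T =
    (u *m alpha c q) *m (v *m alpha c q)^T + (u *m P c q) *m h c q *m (v *m P c q)^T.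
  by rewrite /g mulmxDr mulmxDl !trmx_mul !mulmxA.
have g_change c c' q (u v : 'rV[R]_m) : dom c q -> dom c' q ->
    u *m g c q *m v^T = dtrans c c' q u *m g c' q *m (dtrans c c' q v)^T.
  move=> cq c'q.
  have uP' w : dtrans c c' q (w *m P c q) = dtrans c c' q w *m P c' q.
    by rewrite !uP dtrans_linear// -(vf_change X cq c'q) -(of_change alpha _ cq c'q).
  rewrite !gE -!(of_change alpha _ cq c'q) (rm_change h _ _ cq c'q).
  by rewrite !uP'.
have g_sym c q : dom c q -> (g c q)^T = g c q.
  move=> cq; rewrite /g linearD/= !trmx_mul !trmxK rm_sym//; congr (_ + _).
  by rewrite mulmxA.
have g_pos c q (v : 'rV[R]_m) : dom c q -> v != 0 -> 0 < (v *m g c q *m v^T) 0 0.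
  (* Either [v] has a nonzero projection to [ker alpha], on which [h] is positive, or [v] is
     [alpha(v)] times [X] and then [alpha(v)] is nonzero. *)
  move=> cq v0; rewrite gE mxE; have [vP0|vP0] := eqVneq (v *m P c q) 0; last first.
    by rewrite ltr_wpDl// ?mulmx_trmx_ge0// rm_pos.
  rewrite vP0 !mul0mx [X in _ + X]mxE addr0; apply: mulmx_trmx_gt0.
  apply: contra_neq v0 => va0; move: vP0.
  by rewrite uP va0 mxE oppr0 scale0r add0r.
have g_smooth c : smooth_on (phi c @` dom c) (g c \o psi c).
  move=> k; have oU : open (phi c @` dom c) by exact: cod_open.
  have Ca := @of_smooth _ _ _ alpha c k; have CX := @vf_smooth _ _ _ X c k.
  have CP : Ck k (phi c @` dom c) (P c \o psi c).
    apply: (@Ck_eq _ _ _ _ _ (fun x => 1%:M + -1 *: (alpha c (psi c x) *m X c (psi c x)))) => //.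
      by move=> x _; rewrite scaleN1r.
    apply: CkD => //; first exact: Ck_cst.
    apply: Ck_scale => //; first exact: Ck_cst.
    exact: Ck_mulmx.
  apply: CkD => //.
    by apply: Ck_mulmx => //; exact: Ck_tr.
  apply: Ck_mulmx => //; last exact: Ck_tr.
  by apply: Ck_mulmx => //; exact: rm_smooth.
exists (RiemannianMetric g_change g_sym g_pos g_smooth) => c q cq /=.
have XP : X c q *m P c q = 0.
  by rewrite uP Reeb_alpha// mxE eqxx mulr1n scaleN1r addNr.
by rewrite /g mulmxDr !mulmxA XP !mul0mx addr0 Reeb_alpha// mul1mx.
Qed.
End reeb_metric.

(** * Derivatives of tensors and curves in charts *)

Section chart_calculus.
Context {R : realType} {m : nat} (M : manifold R m).
Implicit Types (c : charts M) (q : M) (f : M -> R).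

Lemma is_derive_entry p n (F : charts M -> M -> 'M[R]_(p, n)) c q i k l :
  smooth_on (phi c @` dom c) (F c \o psi c) -> dom c q ->
  is_derive (phi c q) (delta_mx 0 i : 'rV[R]_m) ((fun p => F c p k l) \o psi c)
    (partial c i (fun p => F c p k l) q).
Proof.
move=> /(_ 1%N) /(Ck_mx _ _ (@cod_open _ _ M c))/(_ k l) CF cq.
by have := Ck_is_derive (delta_mx 0 i) CF; apply; exists q.
Qed.

Lemma partial_eq c i q (W : set M) f f' : open W -> W q -> dom c q ->
  (forall p, dom c p -> W p -> f p = f' p) -> partial c i f q = partial c i f' q.
Proof.
move=> oW Wq cq ff'; apply: near_eq_derive.
have := near_chart cq oW Wq; apply: filterS => x [p [cp Wp _ xp]].
by rewrite /= xp ff'.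
Qed.

Lemma is_derive_sumM (V : normedModType R) n (f f' : 'I_n -> V -> R) x v
    (df df' : 'I_n -> R) :
  (forall j, is_derive x v (f j) (df j)) -> (forall j, is_derive x v (f' j) (df' j)) ->
  is_derive x v (fun y => \sum_j f j y * f' j y) (\sum_j (f j x * df' j + f' j x * df j)).
Proof.
move=> fd fd'.
have -> : (fun y => \sum_j f j y * f' j y) = \sum_j (f j * f' j).
  by apply/funext => y; rewrite fct_sumE.
by apply: is_derive_sum => j; exact: is_deriveM.
Qed.

Lemma is_derive_curve (gamma : R -> M) c t : smooth_curve gamma -> dom c (gamma t) ->
  is_derive t 1 (fun s => phi c (gamma s)) (velocity gamma c t).
Proof.
move=> [_ /(_ c 1%N) Cg] ct; rewrite /velocity derive1E.
exact: Ck_is_derive Cg ct.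
Qed.

Lemma near_curve_dom (gamma : R -> M) c t : smooth_curve gamma -> dom c (gamma t) ->
  \forall s \near t, dom c (gamma s).
Proof.
move=> [gc _] ct; apply: (gc t); apply: open_nbhs_nbhs; split=> //.
exact: dom_open.
Qed.
End chart_calculus.

(** * Acceleration and energy of Reeb orbits *)

Section reeb_geodesic.
Context {R : realType} {m : nat} (M : manifold R m).
Variables (alpha : one_form M) (X : vector_field M) (g : riemannian_metric M).
Variable U : set M.
Hypothesis X_Reeb : is_Reeb alpha X.
Hypothesis U_open : open U.
Hypothesis XgE : forall c q, U q -> dom c q -> X c q *m g c q = (alpha c q)^T.
Implicit Types (c : charts M) (q : M).

Lemma Reeb_acceleration (gamma : R -> M) (s : R) c t : smooth_curve gamma ->
  (forall c t, dom c (gamma t) -> velocity gamma c t = s *: X c (gamma t)) ->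
  U (gamma t) -> dom c (gamma t) -> covariant_acceleration g gamma c t = 0.
Proof.
move=> sg gX Ut ct; set q := gamma t in Ut ct *.
have oC := @cod_open _ _ M c; have Cq : (phi c @` dom c) (phi c q) by exists q.
pose dX i k := partial c i (fun p => X c p 0 k) q.
(* One factor [s] comes from the velocity being [s *: X], the other from the chain rule along the
   curve. The Christoffel term is quadratic in the velocity, so [s ^+ 2] factors out of the whole
   acceleration. *)
have acc k : derive1 (velocity gamma c) t 0 k = s ^+ 2 * \sum_i X c q 0 i * dX i k.
  have /(Ck_mx _ _ oC)/(_ 0 k) CX := @vf_smooth _ _ _ X c 1%N.
  have udu := is_derive_curve sg ct; rewrite gX// in udu.
  have dF := @C1_comp _ _ _ _ (X c \o psi c) _ _ _ _ _ _ oC Cq (@vf_smooth _ _ _ X c 1%N) udu.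
  have E : \forall r \near t,
      s *: ((X c \o psi c) \o (fun r => phi c (gamma r))) r = velocity gamma c r.
    have := near_curve_dom sg ct; apply: filterS => r cr.
    by rewrite gX//= phiK.
  have [_ dE] := near_eq_is_derive E (is_deriveZ s dF).
  have [dXx _] := Ck_is_derive (s *: X c q) (@vf_smooth _ _ _ X c 1%N) Cq.
  rewrite derive1E dE mxE derive_mx// mxE.
  rewrite (C1_derive_sum _ oC Cq CX) !mulr_sumr; apply: eq_bigr => i _.
  by rewrite mxE /dX /partial /=; set d := 'D_ _ _ _; ring.
apply/rowP => k; rewrite /covariant_acceleration [LHS]mxE acc [X in _ + X]mxE mxE.
transitivity (s ^+ 2 * (\sum_i X c q 0 i * dX i k + \sum_i \sum_j
    christoffel g c q k i j * X c q 0 i * X c q 0 j)).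
  rewrite mulrDr; congr (_ + _); rewrite mulr_sumr; apply: eq_bigr => i _.
  rewrite mulr_sumr; apply: eq_bigr => j _; rewrite gX// !mxE; ring.
have [Xa Xda] := X_Reeb ct.
rewrite /christoffel (@geodesic_sum _ _ (g c q) (fun i => X c q 0 i)
  (fun i => alpha c q i 0) dX (fun i l => partial c i (fun p => alpha c p l 0) q)
  (fun i j l => partial c i (fun p => g c p j l) q)) ?mulr0//.
- exact: rm_sym.
- exact: metric_unit.
- by move=> l; have /matrixP/(_ 0 l) := XgE Ut ct; rewrite !mxE => <-.
- move=> i l.
  (* The only place where the identity between [g] and [alpha] is differentiated, hence where [U]
     must be open. *)
  rewrite (@partial_eq _ _ M c i q U _ (fun p => \sum_j X c p 0 j * g c p j l))//; last first.
    by move=> p cp Up; have /matrixP/(_ 0 l) := XgE Up cp; rewrite !mxE.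
  have [_ dE] := is_derive_sumM
    (fun j => is_derive_entry i 0 j (@vf_smooth _ _ _ X c) ct)
    (fun j => is_derive_entry i j l (@rm_smooth _ _ _ g c) ct).
  by apply: (etrans dE); rewrite /= phiK.
- move=> l.
  have [_ dE] := is_derive_sumM
    (fun j => is_derive_entry l 0 j (@vf_smooth _ _ _ X c) ct)
    (fun j => is_derive_entry l j 0 (@of_smooth _ _ _ alpha c) ct).
  have pE : partial c l (fun p => \sum_j X c p 0 j * alpha c p j 0) q =
      partial c l (cst 1) q.
    apply: (@partial_eq _ _ M c l q (dom c)) => //; first exact: dom_open.
    by move=> p cp _; have [+ _] := X_Reeb cp; rewrite mxE.
  have := etrans (esym dE) pE; rewrite /= phiK// => ->.
  by rewrite /partial; exact: derive_cst.
- move=> l; have /matrixP/(_ 0 l) := Xda; rewrite [LHS]mxE [RHS]mxE => XdaE.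
  by rewrite -[RHS]XdaE; apply: eq_bigr => i _; rewrite mxE.
Qed.

Lemma Reeb_magnetic (gamma : R -> M) (s : R) : smooth_curve gamma ->
  (forall c t, dom c (gamma t) -> velocity gamma c t = s *: X c (gamma t)) ->
  range gamma `<=` U -> magnetic_geodesic g alpha gamma.
Proof.
move=> sg gX gU; split=> // c t ct; rewrite (Reeb_acceleration sg gX)//; last first.
  by apply: gU; exists t.
rewrite gX// /lorentz_force mulmxA -scalemxAl; have [_ ->] := X_Reeb ct.
by rewrite scaler0 mul0mx.
Qed.

Definition scaled_vector (s : R) (q : M) : tangent_bundle M.
Proof.
refine (@TangentVector R m M q
  (fun c => if `[< dom c q >] then s *: X c q else 0) _ _).
- move=> c c' cq c'q; rewrite !asboolT// (vf_change X cq c'q).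
  have := dtrans_linear s (X c q) 0 cq c'q.
  by rewrite !addr0 => ->; rewrite [X in _ + X]derive0 addr0.
- by move=> c cq; rewrite asboolF.
Defined.

Lemma Reeb_orbit_energy (gamma : R -> M) (T kappa : R) :
  integral_curve X gamma -> Defs.periodic gamma T -> range gamma `<=` U -> 0 < kappa ->
  has_periodic_orbit_of_energy g alpha kappa.
Proof.
(* [X] has unit length on [U], so running the orbit at speed [s] gives energy [s ^+ 2 / 2] and
   period [T / s]. *)
move=> [[gc sg] gX] [T0 gT] gU k0; pose s := Num.sqrt (2 * kappa).
have s0 : 0 < s by rewrite sqrtr_gt0 mulr_gt0.
have s2 : s ^+ 2 = 2 * kappa by rewrite sqr_sqrtr// mulr_ge0// ltW.
pose gs t := gamma (s * t).
have sgs : smooth_curve gs.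
  split.
    move=> t; apply: (@continuous_comp _ _ _ ( *%R s) gamma); last exact: gc.
    exact: mulrl_continuous.
  move=> c k; exact: (Ck_rescale s (sg c k)).
have gsX c t : dom c (gs t) -> velocity gs c t = s *: X c (gs t).
  move=> ct.
  have [fd fE] := is_derive_curve (conj gc sg) ct; rewrite gX// in fE.
  have /derivable1_diffP fdiff := fd.
  rewrite /velocity derive1E.
  have E := congr1 (@^~ t) (derive_rescale (fun r : R => phi c (gamma r)) s 1).1.
  by apply: (etrans E); rewrite /= deriveE// linearZ/= -deriveE// fE.
exists (fun t => scaled_vector s (gs t)), (T / s); split.
- exists gs; first by apply: (Reeb_magnetic sgs gsX) => q [t _ <-]; apply: gU; exists (s * t).
  by move=> t; split=> //= c ct; rewrite asboolT// gsX.
- split; first by rewrite divr_gt0.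
  by move=> t; rewrite /gs mulrDr [s * (T / s)]mulrC divfK ?gt_eqF// gT.
- move=> t c /= ct; rewrite asboolT//.
  rewrite -scalemxAl XgE//; last by apply: gU; exists (s * t).
  rewrite linearZ/= -scalemxAl -scalemxAr scalerA -trmx_mul Reeb_alpha//.
  by rewrite trmx1 mxE mxE eqxx mulr1 -expr2 s2 mulrA mulVf ?mul1r// pnatr_eq0.
Qed.
End reeb_geodesic.

(** * Periodic integral curves *)

Lemma C1_locally_lipschitz_rV (R : realType) m n (U : set 'rV[R]_m)
    (F : 'rV[R]_m -> 'rV[R]_n) x : open U -> U x -> Ck 1 U F ->
  exists2 L : R, 0 < L & exists2 r : R, 0 < r &
    forall y z, ball x r y -> ball x r z -> `|F y - F z| <= L * `|y - z|.
Proof.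
move=> oU Ux /(Ck_mx _ _ oU) CF.
have H j : exists Lr : R * R, [/\ 0 < Lr.1, 0 < Lr.2 &
    forall y z, ball x Lr.2 y -> ball x Lr.2 z ->
      `|F y 0 j - F z 0 j| <= Lr.1 * `|y - z|].
  have [L L0 [r r0 HL]] := C1_locally_lipschitz oU Ux (CF 0 j).
  by exists (L, r).
have [Lr LrP] := choice H.
pose P j y := ball x (Lr j).2 y.
have : nbhs x [set y | forall j, P j y].
  apply: (@filter_forall _ _ P (nbhs x) (nbhs_filter x)) => j.
  by apply: nbhsx_ballx; case: (LrP j).
move=> /nbhs_ballP[r /= r0 rP].
exists (1 + \sum_j (Lr j).1).
  by rewrite ltr_wpDr// sumr_ge0// => j _; case: (LrP j) => /ltW.
exists r => // y z /rP yP /rP zP; apply: normr_mx_le.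
  by rewrite mulr_ge0// addr_ge0// sumr_ge0// => j _; case: (LrP j) => /ltW.
move=> i j; rewrite (ord1 i) !mxE; case: (LrP j) => L0 _ /(_ _ _ (yP j) (zP j)).
move=> /le_trans; apply; rewrite ler_wpM2r// (bigD1 j)//= addrCA lerDl addr_ge0//.
by apply: sumr_ge0 => k _; case: (LrP k) => /ltW.
Qed.

Lemma periodic_mulz (R : realType) (T : Type) (f : R -> T) p (k : int) t :
  Defs.periodic f p -> f (t + k%:~R * p) = f t.
Proof.
move=> [_ fp].
have fpn (n : nat) r : f (r + n%:R * p) = f r.
  elim: n => [|n IH]; first by rewrite mul0r addr0.
  by rewrite -natr1 mulrDl mul1r addrA fp.
case: k => n; first exact: fpn.
by rewrite NegzE mulrNz mulNr -(fpn n.+1 (t - _)) subrK.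
Qed.

Lemma euclidean_multiple (R : realType) (x p : R) : 0 < p ->
  exists k : int, k%:~R * p <= x < k%:~R * p + p.
Proof.
move=> p0; exists (Num.floor (x / p)).
rewrite -[X in _ + X]mul1r -mulrDl -ler_pdivlMr// -ltr_pdivrMr//.
by rewrite floor_le_tmp -[1]/(1%:~R) -intrD floorD1_gt.
Qed.

Section flow.
Context {R : realType} {m : nat} (M : manifold R m) (X : vector_field M).
Implicit Types (c : charts M) (q : M).

(** Keeps from [integral_curve] only continuity and the equation, which is all that uniqueness uses
    and is easily transported by time shifts. *)
Definition solution (gamma : R -> M) := continuous gamma /\
  forall c t, dom c (gamma t) ->
    is_derive t 1 (fun s => phi c (gamma s)) (X c (gamma t)).

Lemma integral_curve_solution gamma : integral_curve X gamma -> solution gamma.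
Proof.
move=> [sg gX]; split; first by case: sg.
by move=> c t ct; rewrite -gX//; exact: is_derive_curve.
Qed.

Lemma solution_shift gamma (a : R) : solution gamma -> solution (fun t => gamma (t + a)).
Proof.
move=> [gc gX]; split=> [t|c t ct].
  apply: (@continuous_comp _ _ _ (+%R^~ a) gamma); last exact: gc.
  by apply: cvgD; [exact: cvg_id|exact: cvg_cst].
have H : is_derive (t *: 1 + a) 1 (fun s : R => phi c (gamma s)) (X c (gamma (t + a))).
  by rewrite [t *: 1]mulr1; exact: gX.
have := (is_derive_alongP _ _ _ _ _).2 H.
have -> // : (fun h : R => phi c (gamma (h *: 1 + a))) = (fun h : R => phi c (gamma (h + a))).
by apply/funext => h; rewrite [h *: 1]mulr1.
Qed.

(* At a maximum of [|u - u'|] on a small interval, the mean value theorem and the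
   Lipschitz bound on the field give [|u - u'| <= |u - u'| / 2]. *)
Lemma solution_locally_unique gamma gamma' r0 : solution gamma -> solution gamma' ->
  gamma r0 = gamma' r0 -> \forall r \near r0, gamma r = gamma' r.
Proof.
move=> [gc gX] [gc' gX'] g0.
have [c cq] := dom_cover (gamma r0); set x0 := phi c (gamma r0).
have oC := @cod_open _ _ M c.
have Cx : (phi c @` dom c) x0 by exists (gamma r0).
have [L L0 [e e0 FL]] := C1_locally_lipschitz_rV oC Cx (@vf_smooth _ _ _ X c 1%N).
pose u r := phi c (gamma r); pose u' r := phi c (gamma' r).
have c'q : dom c (gamma' r0) by rewrite -g0.
have near_ok g : solution g -> g r0 = gamma r0 ->
    \forall r \near r0, dom c (g r) /\ ball x0 e (phi c (g r)).
  move=> [cg gX0] gr0; near=> r; split.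
    near: r; apply: (cg r0); rewrite gr0; apply: open_nbhs_nbhs; split=> //.
    exact: dom_open.
  near: r.
  have cr0 : dom c (g r0) by rewrite gr0.
  have := continuous_comp (cg r0) (phi_continuous cr0).
  by move=> /(_ (ball x0 e)); apply; rewrite /= gr0; exact: nbhsx_ballx.
have : \forall r \near r0,
    [/\ dom c (gamma r), ball x0 e (u r), dom c (gamma' r) & ball x0 e (u' r)].
  near=> r.
  have [] : dom c (gamma r) /\ ball x0 e (u r) by near: r; exact: near_ok.
  by have [] : dom c (gamma' r) /\ ball x0 e (u' r) by near: r; exact: near_ok.
move=> /nbhs_ballP[d0 /= d00 d0P].
(* The first bound keeps both curves in the chart and in the ball where the field is Lipschitz; the
   second gives [L * d <= 1/2]. *)
pose d := Num.min (d0 / 2) (L^-1 / 2).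
have d_gt0 : 0 < d by rewrite lt_min !divr_gt0// invr_gt0.
have dd0 : d < d0.
  by rewrite gt_min ltr_pdivrMr// ltr_pMr// ltr1n.
have dL : L * d <= 2^-1.
  rewrite -ler_pdivlMl// ge_min; apply/orP; right; by rewrite mulrC.
have inI r : r0 - d <= r <= r0 + d ->
    [/\ dom c (gamma r), ball x0 e (u r), dom c (gamma' r) & ball x0 e (u' r)].
  move=> rd; apply: d0P; rewrite /ball/= distrC; apply: le_lt_trans dd0.
  by rewrite ler_distl.
pose D r := u r - u' r; pose F := X c \o psi c.
have dD r : r0 - d <= r <= r0 + d -> is_derive r 1 D (F (u r) - F (u' r)).
  move=> /inI[cr _ cr' _]; apply: is_deriveB; rewrite /F /= phiK//.
    exact: gX.
  exact: gX'.
pose N r := `|D r|.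
have [||r1 r1I r1max] := @EVT_max R N (r0 - d) (r0 + d).
- by rewrite lerD2l ge0_cp// ltW.
- apply: continuous_in_subspaceT => r; rewrite inE/= in_itv/= => rI.
  apply: (@continuous_comp _ _ _ D (fun y => `|y|)); last exact: norm_continuous.
  by apply/differentiable_continuous/derivable1_diffP; case: (dD r rI).
rewrite in_itv/= in r1I.
have D0 : D r0 = 0 by rewrite /D /u /u' g0 subrr.
have r0I : r0 - d <= r0 <= r0 + d by rewrite lerDl gerBl ltW.
have N1 : N r1 <= 2^-1 * N r1.
  apply: normr_mx_le.
    by apply: mulr_ge0; [rewrite invr_ge0|exact: normr_ge0].
  move=> i j; rewrite (ord1 i).
  have sub t : Num.min r0 r1 <= t <= Num.max r0 r1 -> r0 - d <= t <= r0 + d.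
    move: r0I r1I => /andP[a1 a2] /andP[a3 a4].
    by case: (leP r0 r1) => _ /andP[a5 a6]; apply/andP; split; lra.
  have := @MVT_norm R (fun t => D t 0 j) (fun t => (F (u t) - F (u' t)) 0 j) r0 r1 (L * N r1).
  rewrite D0 [X in _ - X]mxE subr0 => H.
  apply: (le_trans (H _ _)).
  + move=> t /sub/dD[dt dE]; apply: DeriveDef.
      by move/derivable_mxP : dt; exact.
    by rewrite -dE derive_mx// mxE.
  + move=> t /sub tI; apply: (le_trans (normr_coord_le _ _ _)).
    have [_ b1 _ b2] := inI t tI; apply: (le_trans (FL _ _ b1 b2)).
    by rewrite ler_wpM2l ?(ltW L0)//; apply: r1max; rewrite in_itv.
  + rewrite mulrAC ler_wpM2r ?normr_ge0// (le_trans _ dL)// ler_wpM2l ?(ltW L0)//.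
    by rewrite ler_distl.
have N10 : N r1 <= 0 by lra.
have nd : \forall r \near r0, `|r0 - r| <= d.
  by apply/nbhs_ballP; exists d => //= r /ltW.
near=> r.
have rI : r0 - d <= r <= r0 + d.
  by rewrite -ler_distl distrC; near: r.
have Nr : N r <= 0 by apply: le_trans N10; apply: r1max; rewrite in_itv.
move: Nr; rewrite normr_le0 subr_eq0 => /eqP uu'.
by have [cr _ cr' _] := inI r rI; rewrite -(phiK cr) -(phiK cr') -/(u r) uu'.
Unshelve. all: by end_near. Qed.

(** The set of agreement is open by local uniqueness and closed because [M] is Hausdorff, and the
    line is connected. *)
Lemma solution_unique gamma gamma' r0 : solution gamma -> solution gamma' ->
  gamma r0 = gamma' r0 -> gamma = gamma'.
Proof.
move=> s s' g0; pose A := [set r | gamma r = gamma' r].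
have AT : A = setT.
  have /connected_intervalP : is_interval [set: R] by [].
  apply; first by exists r0.
  - exists A; last by rewrite setTI.
    rewrite openE => r Ar; exact: solution_locally_unique Ar.
  - exists A; last by rewrite setTI.
    rewrite -openC openE => r /= /eqP Ar.
    have := @points_hausdorff _ _ M; rewrite open_hausdorff => /(_ _ _ Ar).
    move=> [[V W] /= []]; rewrite !inE => Vr Wr [oV oW VW].
    near=> t => /= At; suff : (V `&` W) (gamma t) by rewrite VW.
    split; last rewrite At; near: t.
      by case: s => gc _; apply: (gc r); exact: open_nbhs_nbhs.
    by case: s' => gc _; apply: (gc r); exact: open_nbhs_nbhs.
by apply/funext => r; have : A r by rewrite AT.
Unshelve. all: by end_near. Qed.

(** Some coordinate of [X] at [gamma 0] is nonzero. A return to [gamma 0] at time [h] would make the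
    difference quotient of that coordinate vanish, whereas for small [h] it is closer to its limit
    than the limit is to 0. *)
Lemma solution_locally_injective gamma : solution gamma -> (forall c q, dom c q -> X c q != 0) ->
  exists2 d : R, 0 < d & forall h, 0 < h < d -> gamma h <> gamma 0.
Proof.
move=> [gc gX] X0; have [c c0] := dom_cover (gamma 0).
have /rV0Pn[j Xj] := X0 _ _ c0; have [df dE] := gX c 0 c0.
have dfj : derivable (fun s => phi c (gamma s) 0 j) (0 : R) 1.
  by move/derivable_mxP : (df); exact.
have dEj : 'D_1 (fun s : R => phi c (gamma s) 0 j) 0 = X c (gamma 0) 0 j.
  by rewrite -dE derive_mx// mxE.
move: (dfj); rewrite /derivable => /cvgrPdist_lt.
rewrite -[lim _]/('D_1 (fun s : R => phi c (gamma s) 0 j) 0) dEj.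
move=> /(_ _ (ltac:(by rewrite normr_gt0; exact: Xj) : 0 < `|X c (gamma 0) 0 j|)).
move=> [d /= d0 dP]; exists d => // h /andP[h0 hd] gh.
have := dP h; rewrite /ball_/= sub0r normrN gtr0_norm// => /(_ hd).
rewrite addr0 [h *: 1]mulr1 gh subrr scaler0 subr0 ltxx => H.
by apply: (notF (H _)); rewrite gt_eqF.
Qed.

(* The positive periods are bounded below by local injectivity and stable under
   positive differences, hence their infimum is attained. *)
Lemma minimal_period gamma T : solution gamma -> (forall c q, dom c q -> X c q != 0) ->
  Defs.periodic gamma T -> exists2 T0, Defs.periodic gamma T0 &
    forall s t, gamma s = gamma t -> exists k : int, s = t + k%:~R * T0.
Proof.
move=> sg X0 gT.
have [d d0 dP] := solution_locally_injective sg X0.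
pose P := [set p | Defs.periodic gamma p].
have Pd p : P p -> d <= p.
  move=> [p0 gp]; rewrite leNgt; apply/negP => pd.
  by apply: (dP p); [rewrite p0|rewrite -[p]add0r gp].
have Psub p p' : P p -> P p' -> p' < p -> P (p - p').
  move=> [p0 gp] [p'0 gp'] pp'; split; first by rewrite subr_gt0.
  by move=> t; rewrite -gp' addrA subrK gp.
have Pinf : has_inf P.
  by split; [exists T|exists d => p /Pd].
(* [p] exceeds the infimum by less than [d], so a smaller period [p'] would make [p - p'] a period
   shorter than [d]. *)
have [p Pp pinf] := inf_adherent d0 Pinf.
have pmin p' : P p' -> p <= p'.
  move=> Pp'; rewrite leNgt; apply/negP => p'p.
  have := Pd _ (Psub _ _ Pp Pp' p'p).
  have : inf P <= p' by apply: ge_inf => //; case: Pinf.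
  lra.
exists p => // s t gst; have [p0 gp] := Pp.
have gpk k r := periodic_mulz k r Pp.
have [k ks] := euclidean_multiple (s - t) p0.
(* [r] is the remainder of [s - t] modulo [p]. If it were positive, uniqueness of solutions would
   make it a period smaller than [p]. *)
exists k; pose r := s - t - k%:~R * p.
have [r0|r0] := ltP 0 r; last first.
  by move/andP: ks => [ks _]; move: r0; rewrite /r => r0; lra.
have : P r; last first.
  move=> /pmin; move: ks => /andP[_]; rewrite /r; lra.
split=> // u.
have E : (fun v => gamma (v + (s - k%:~R * p))) = (fun v => gamma (v + t)).
  apply: (solution_unique (r0 := 0) (solution_shift _ sg) (solution_shift _ sg)).
  by rewrite !add0r -gst -(gpk k (s - _)) subrK.
have := congr1 (@^~ (u - t)) E; rewrite /= subrK => <-; congr gamma.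
by rewrite /r; lra.
Qed.

Lemma periodic_solution_embedded gamma T : solution gamma ->
  Defs.periodic gamma T -> smooth_curve gamma -> (forall c q, dom c q -> X c q != 0) ->
  (forall s t, gamma s = gamma t -> exists k : int, s = t + k%:~R * T) ->
  embedded_loop gamma T.
Proof.
move=> sg [T0 gT] smg X0 ginj; split=> //.
  move=> c t ct; have [_ dE] := sg.2 c t ct.
  by rewrite /velocity derive1E dE X0.
(* [K] is the image of the times at distance at least [e] from [t] modulo [T]. It is compact, hence
   closed, and misses [gamma t] by injectivity modulo [T], so its complement is the required
   neighbourhood. *)
move=> t e e0; pose K := gamma @` `[t + e, t + T - e]%classic.
have cK : closed K.
  apply: compact_closed; first exact: points_hausdorff.
  apply: continuous_compact; last exact: segment_compact.
  by apply: continuous_subspaceT; case: sg.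
have nK : ~ K (gamma t).
  move=> [s /=]; rewrite in_itv/= => /andP[s1 s2] /ginj[k sE].
  have k0 : 0 < k%:~R * T by lra.
  have k1 : k%:~R * T < 1 * T by lra.
  by move: k0 k1; rewrite pmulr_lgt0// ltr_pM2r// ltr0z ltrz1 gtz0_ge1 leNgt => /negbTE->.
exists (~` K).
  by apply: open_nbhs_nbhs; split=> //; exact: closed_openC.
have gpk k r := periodic_mulz k r (conj T0 gT).
move=> s Ks; have [k ks] := euclidean_multiple (s - t) T0.
move: ks => /andP[ks1 ks2].
(* The remainder of [s - t] modulo [T] is within [e] of 0 or of [T]; in the latter case the nearest
   multiple is the next one, [k + 1]. *)
have [r1|r1] := ltP (s - t - k%:~R * T) e.
  by exists k; rewrite ger0_norm//; lra.
exists (k + 1); rewrite intrD mulrDl mul1r ltr0_norm; last by lra.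
rewrite ltNge; apply/negP => r2; apply: Ks; exists (s - k%:~R * T).
  by rewrite /= in_itv/=; apply/andP; split; lra.
by rewrite -(gpk k) subrK.
Qed.

End flow.

Theorem corollary9 (R : realType) (n : nat) (M : manifold R n.*2.+1)
    (alpha : one_form M)
    (M_compact : compact [set: M]) (M_connected : connected [set: M])
    (alpha_contact : contact_form alpha)
    (weinstein : has_periodic_Reeb_orbit alpha) :
  exists (g : riemannian_metric M) (gamma : R -> M) (T : R),
    [/\ geodesic_type_loop g alpha gamma T,
        forall kappa : R, 0 < kappa -> has_periodic_orbit_of_energy g alpha kappa &
        forall (U : set M) (g' : riemannian_metric M),
          open U -> range gamma `<=` U -> metric_eq_on U g g' ->
          geodesic_type g' alpha /\
          forall kappa : R, 0 < kappa -> has_periodic_orbit_of_energy g' alpha kappa].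
Proof.
have [X X_Reeb [gamma [T [gX gT]]]] := weinstein.
have X0 := Reeb_neq0 X_Reeb.
have sol := integral_curve_solution gX.
have [T0 gT0 ginj] := minimal_period sol X0 gT.
have emb := periodic_solution_embedded sol gT0 gX.1 X0 ginj.
have [h] := riemannian_metric_exists (gamma 0) M_compact.
have [g gE] := Reeb_metric X_Reeb h.
(* Proved for all admissible [g'] at once; the claims about [g] itself are the case of [g' = g] with
   [U] the whole manifold. *)
have loop U g' : open U -> range gamma `<=` U -> metric_eq_on U g g' ->
    geodesic_type_loop g' alpha gamma T0 /\
    forall kappa, 0 < kappa -> has_periodic_orbit_of_energy g' alpha kappa.
  move=> oU gU gg'.
  have g'E c q : U q -> dom c q -> X c q *m g' c q = (alpha c q)^T.
    by move=> Uq cq; rewrite -gg'// gE.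
  have v1 c t : dom c (gamma t) -> velocity gamma c t = 1 *: X c (gamma t).
    by move=> ct; rewrite scale1r; exact: gX.2.
  split; last by move=> kappa; exact: (Reeb_orbit_energy X_Reeb oU g'E gX gT0 gU).
  split=> //.
    split=> [|c t ct]; first exact: gX.1.
    by apply: (Reeb_acceleration X_Reeb oU g'E gX.1 v1) => //; apply: gU; exists t.
  by move=> c t ct; rewrite gX.2//; case: (X_Reeb _ _ ct).
exists g, gamma, T0; have [gl ge] := loop setT g openT (@subsetT _ _) (fun _ _ _ _ => erefl).
split=> // U g' oU gU gg'; have [gl' ge'] := loop U g' oU gU gg'.
by split=> //; exists gamma, T0.
Qed.
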